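(* Let $(M,\omega)$ be a multisymplectic manifold of order $k$ (that is, $\omega$ is a closed, possibly degenerate, $(k+1)$-form on $M$) and let $1\le q\le k$. Then a multivector field $U: M\to \bigvee_q M$ of order $q$ is locally Hamiltonian if and only if its image $U(M)$ is a $(k+1-q)$-Lagrangian submanifold of $(\bigvee_q M,\widetilde\Omega^q_M)$.
   Context: $\bigvee_q M=\bigwedge^q TM$ is the bundle of $q$-vectors over $M$, and $\bigwedge^m M=\bigwedge^m T^*M$ is the bundle of $m$-forms. A multivector field of order $q$ is a smooth section $U$ of $\bigvee_q M$. For a $q$-vector $u=u_1\wedge\cdots\wedge u_q$, $\iota_u\omega=\omega(u_1,\dots,u_q,\cdot,\dots,\cdot)$ (extended linearly). $U$ is locally Hamiltonian if $\iota_U\omega$ is closed. A multisymplectic manifold of order $k$ is a pair $(M,\omega)$ with $\omega$ a closed $(k+1)$-form; no nondegeneracy is assumed. Canonical form on $\bigwedge^m M$: with $\pi:\bigwedge^m M\to M$ the projection, $\Theta^m_M|_{\alpha_x}(v_1,\dots,v_m)=\alpha_x(\pi_*v_1,\dots,\pi_*v_m)$ and $\Omega^m_M=-d\Theta^m_M$. The contraction map is $\flat_q:\bigvee_q M\to\bigwedge^{k+1-q}M$, $u\mapsto\iota_u\omega$, and $\widetilde\Omega^q_M:=(\flat_q)^*\Omega_M^{k+1-q}$. This is a closed $(k+2-q)$-form on $\bigvee_q M$, so $(\bigvee_q M,\widetilde\Omega^q_M)$ is a multisymplectic manifold of order $k+1-q$. For a vector space $V$ with $\eta\in\bigwedge^{m+1}V^*$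 (order $m$), a subspace $S\subseteq V$ and $1\le j\le m$: $S^{\perp,j}=\{v\in V:\iota_{v\wedge s_1\wedge\cdots\wedge s_j}\eta=0\ \forall s_1,\dots,s_j\in S\}$, and $\ker\flat_1=\{v\in V:\iota_v\eta=0\}$. $S$ is $j$-Lagrangian if $S^{\perp,j}=S+\ker\flat_1$. A submanifold of a multisymplectic manifold is $j$-Lagrangian if its tangent space at each of its points $x$ is $j$-Lagrangian in the ambient tangent space at $x$. *)

(* Defs.v *)
From mathcomp Require Import all_boot all_order all_algebra.
From mathcomp Require Import all_classical all_reals all_analysis.

Set Implicit Arguments.
Unset Strict Implicit.
Unset Printing Implicit Defensive.

Import Order.TTheory GRing.Theory Num.Theory.
Import numFieldNormedType.Exports.

Local Open Scope classical_set_scope.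
Local Open Scope ring_scope.

(** * Exterior algebra of R^n

    The strictly increasing multi-indices J_0 < ... < J_(p-1) label both the
    basis (e_J) of the q-vectors and the dual basis (e^J) of the alternating
    forms of R^n.  Both spaces are therefore coordinate spaces; they are kept
    apart by name only. *)

Definition incr (n p : nat) (J : {ffun 'I_p -> 'I_n}) : bool :=
  [forall i : 'I_p, forall j : 'I_p, ((i < j) ==> (J i < J j))%N].

Notation midx n p := {J : {ffun 'I_p -> 'I_n} | incr J}.

Definition extdim (n p : nat) : nat := #|{: midx n p}|.

Notation mvec R n q := 'rV[R]_(extdim n q) (only parsing).
Notation aform R n p := 'rV[R]_(extdim n p) (only parsing).

Definition coef (R : realType) (n p : nat) (a : 'rV[R]_(extdim n p))
  (J : midx n p) : R := a 0 (enum_rank J).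

Definition basis_vec (R : realType) (n p : nat) (J : midx n p) (i : 'I_p) :
  'rV[R]_n := delta_mx 0 (val J i).

Definition minor (R : realType) (n p : nat) (v : 'I_p -> 'rV[R]_n)
  (J : midx n p) : R := \det (\matrix_(i < p, j < p) v i 0 (val J j)).

Definition wedge (R : realType) (n q : nat) (u : 'I_q -> 'rV[R]_n) :
  mvec R n q := \row_I minor u (enum_val I).

Definition feval (R : realType) (n p : nat) (a : aform R n p)
  (v : 'I_p -> 'rV[R]_n) : R := \sum_(J : midx n p) coef a J * minor v J.

(* The alternating form whose value is F, provided F is multilinear and
   alternating; it is only applied to such F. *)
Definition mkform (R : realType) (n p : nat) (F : ('I_p -> 'rV[R]_n) -> R) :
  aform R n p := \row_J F (@basis_vec R n p (enum_val J)).

(* The list u_0, ..., u_(q-1), v_0, ..., v_(p-q-1); only used for q <= p. *)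
Definition vcat (R : realType) (n q p : nat) (u : 'I_q -> 'rV[R]_n)
  (v : 'I_(p - q) -> 'rV[R]_n) (i : 'I_p) : 'rV[R]_n :=
  if insub (i : nat) is Some a then u a
  else if insub (i - q)%N is Some b then v b else 0.

Definition vcons (R : realType) (n p : nat) (v : 'rV[R]_n)
  (s : 'I_p -> 'rV[R]_n) (i : 'I_p.+1) : 'rV[R]_n :=
  if unlift ord0 i is Some i' then s i' else v.

(* iota_u a: linear in u, equal to a(u_1, ..., u_q, -) on u_1 /\ ... /\ u_q. *)
Definition contract (R : realType) (n q p : nat) (u : mvec R n q)
  (a : aform R n p) : aform R n (p - q) :=
  mkform (fun v => \sum_(I : midx n q)
    coef u I * feval a (vcat (@basis_vec R n q I) v)).

Definition fpull (R : realType) (n m p : nat) (A : 'rV[R]_n -> 'rV[R]_m)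
  (a : aform R m p) : aform R n p := mkform (fun v => feval a (A \o v)).

Definition mvpush (R : realType) (n m q : nat) (A : 'rV[R]_n -> 'rV[R]_m)
  (u : mvec R n q) : mvec R m q :=
  \sum_(I : midx n q) coef u I *: wedge (A \o @basis_vec R n q I).

(** * Calculus on open subsets of normed spaces *)

Fixpoint Cn_on (R : realType) (V W : normedModType R) (k : nat) (A : set V)
  (f : V -> W) : Prop :=
  match k with
  | 0 => forall x, A x -> {for x, continuous f}
  | k'.+1 => (forall x, A x -> differentiable f x) /\
             (forall v, Cn_on k' A ('D_v f))
  end.

(* C^oo on A; meaningful for A open and V of finite dimension. *)
Definition smooth_on (R : realType) (V W : normedModType R) (A : set V)
  (f : V -> W) : Prop := forall k, Cn_on k A f.

(* da(v_0, ..., v_p) = sum_i (-1)^i D_(v_i) a (v_0, .., ^v_i, .., v_p). *)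
Definition extd (R : realType) (n p : nat) (a : 'rV[R]_n -> aform R n p)
  (y : 'rV[R]_n) : aform R n p.+1 :=
  mkform (fun v => \sum_(i < p.+1)
    (-1) ^+ i * feval ('D_(v i) a y) (fun j => v (lift i j))).

(** * Manifolds

    A manifold is a set with an atlas; its topology is the one determined by
    the atlas. *)

(* [cinv] is meant to be inverse to [cmap] between [cdom] and its image. *)
Record chart (R : realType) (n : nat) (X : Type) := Chart {
  cdom : set X ;
  cmap : X -> 'rV[R]_n ;
  cinv : 'rV[R]_n -> X }.

Definition cimg (R : realType) (n : nat) (X : Type) (c : chart R n X) :
  set 'rV[R]_n := cmap c @` cdom c.

(* Raw data, without axioms.  The distinguished chart [chart_at x] identifies
   the tangent space T_x X with 'rV_n: tangent vectors at x are represented by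
   their components in that chart. *)
Record charted (R : realType) (n : nat) := Charted {
  point :> Type ;
  atlas : set (chart R n point) ;
  chart_at : point -> chart R n point }.
Arguments atlas {R n} c _.

Definition smooth_transition (R : realType) (n : nat) (X : Type)
  (c c' : chart R n X) : Prop :=
  open (cmap c @` (cdom c `&` cdom c')) /\
  smooth_on (cmap c @` (cdom c `&` cdom c')) (cmap c' \o cinv c).

Definition chart_wf (R : realType) (n : nat) (X : Type) (c : chart R n X) :
  Prop := open (cimg c) /\ forall x, cdom c x -> cinv c (cmap c x) = x.

Definition mopen (R : realType) (n : nat) (X : charted R n) (O : set X) : Prop :=
  forall c, atlas X c -> open (cmap c @` (O `&` cdom c)).

Record is_manifold (R : realType) (n : nat) (X : charted R n) : Prop := {
  manifold_chart_at : forall x : X, atlas X (chart_at x) /\ cdom (chart_at x) x ;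
  manifold_wf : forall c, atlas X c -> chart_wf c ;
  manifold_transition : forall c c', atlas X c -> atlas X c' ->
    smooth_transition c c' ;
  manifold_hausdorff : forall x y : X, x <> y -> exists O O' : set X,
    [/\ mopen O, mopen O', O x, O' y & O `&` O' = set0] ;
  manifold_countable : exists B : nat -> set X, (forall i, mopen (B i)) /\
    forall (O : set X) x, mopen O -> O x -> exists i, B i x /\ B i `<=` O }.

Definition smooth_map (R : realType) (n m : nat) (X : charted R n)
  (Y : charted R m) (f : X -> Y) : Prop :=
  forall c d, atlas X c -> atlas Y d ->
    open (cmap c @` (cdom c `&` f @^-1` cdom d)) /\
    smooth_on (cmap c @` (cdom c `&` f @^-1` cdom d)) (cmap d \o f \o cinv c).

Definition tmap (R : realType) (n m : nat) (X : charted R n) (Y : charted R m)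
  (f : X -> Y) (x : X) : 'rV[R]_n -> 'rV[R]_m :=
  'd (cmap (chart_at (f x)) \o f \o cinv (chart_at x)) (cmap (chart_at x) x).

(* From T_x X (components in [chart_at x]) to components in the chart c. *)
Definition tcoord (R : realType) (n : nat) (X : charted R n)
  (c : chart R n X) (x : X) : 'rV[R]_n -> 'rV[R]_n :=
  'd (cmap c \o cinv (chart_at x)) (cmap (chart_at x) x).

(* From components in the chart c to T_x X: the inverse of [tcoord c x]. *)
Definition tvec (R : realType) (n : nat) (X : charted R n)
  (c : chart R n X) (x : X) : 'rV[R]_n -> 'rV[R]_n :=
  'd (cmap (chart_at x) \o cinv c) (cmap c x).

(** * Differential forms *)

Definition dform (R : realType) (n : nat) (X : charted R n) (p : nat) : Type :=
  X -> aform R n p.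

Definition localform (R : realType) (n : nat) (X : charted R n) (p : nat)
  (w : dform X p) (c : chart R n X) (y : 'rV[R]_n) : aform R n p :=
  fpull (tvec c (cinv c y)) (w (cinv c y)).

Definition smooth_form (R : realType) (n : nat) (X : charted R n) (p : nat)
  (w : dform X p) : Prop :=
  forall c, atlas X c -> smooth_on (cimg c) (localform w c).

(* Computed in [chart_at x], whose components are those of T_x X. *)
Definition dext (R : realType) (n : nat) (X : charted R n) (p : nat)
  (w : dform X p) : dform X p.+1 :=
  fun x => extd (localform w (chart_at x)) (cmap (chart_at x) x).

Definition closed_form (R : realType) (n : nat) (X : charted R n) (p : nat)
  (w : dform X p) : Prop := forall x, dext w x = 0.

Definition pullback (R : realType) (n m : nat) (X : charted R n)
  (Y : charted R m) (f : X -> Y) (p : nat) (w : dform Y p) : dform X p :=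
  fun x => fpull (tmap f x) (w (f x)).

Definition multisymplectic (R : realType) (n : nat) (X : charted R n) (k : nat)
  (w : dform X k.+1) : Prop := smooth_form w /\ closed_form w.

(** * Bundles of q-vectors and of m-forms

    For [Fib A A'] the action on the fibre of a linear isomorphism A with
    inverse A', a chart c of X induces the chart
      (x, u) |-> (c x, Fib (tcoord c x) (tvec c x) u). *)

Definition bundle_chart (R : realType) (n N : nat) (X : charted R n)
  (Fib : ('rV[R]_n -> 'rV[R]_n) -> ('rV[R]_n -> 'rV[R]_n) ->
         'rV[R]_N -> 'rV[R]_N)
  (c : chart R n X) : chart R (n + N) (X * 'rV[R]_N)%type :=
  Chart
    [set z | cdom c z.1]
    (fun z => row_mx (cmap c z.1) (Fib (tcoord c z.1) (tvec c z.1) z.2))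
    (fun y => let x := cinv c (lsubmx y) in
              (x, Fib (tvec c x) (tcoord c x) (rsubmx y))).

Definition bundle (R : realType) (n N : nat) (X : charted R n)
  (Fib : ('rV[R]_n -> 'rV[R]_n) -> ('rV[R]_n -> 'rV[R]_n) ->
         'rV[R]_N -> 'rV[R]_N) : charted R (n + N) :=
  Charted [set bundle_chart Fib c | c in atlas X]
          (fun z => bundle_chart Fib (chart_at z.1)).

Definition mvbundle (R : realType) (n : nat) (X : charted R n) (q : nat) :
  charted R (n + extdim n q) :=
  bundle X (fun A _ => @mvpush R n n q A).

Definition formbundle (R : realType) (n : nat) (X : charted R n) (m : nat) :
  charted R (n + extdim n m) :=
  bundle X (fun _ A' => @fpull R n n m A').

Definition mvproj (R : realType) (n : nat) (X : charted R n) (q : nat)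
  (z : mvbundle X q) : X := z.1.

Definition formproj (R : realType) (n : nat) (X : charted R n) (m : nat)
  (z : formbundle X m) : X := z.1.

Definition Theta (R : realType) (n : nat) (X : charted R n) (m : nat) :
  dform (formbundle X m) m :=
  fun z => mkform (fun v => feval (z.2 : aform R n m)
                              (tmap (@formproj R n X m) z \o v)).

Definition Omega (R : realType) (n : nat) (X : charted R n) (m : nat) :
  dform (formbundle X m) m.+1 := fun z => - dext (@Theta R n X m) z.

Definition flat (R : realType) (n k : nat) (M : charted R n) (q : nat)
  (w : dform M k.+1) (z : mvbundle M q) : formbundle M (k.+1 - q) :=
  (z.1, contract (z.2 : mvec R n q) (w z.1)).

Definition Omega_tilde (R : realType) (n k : nat) (M : charted R n) (q : nat)
  (w : dform M k.+1) : dform (mvbundle M q) (k.+1 - q).+1 :=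
  pullback (flat (q := q) w) (@Omega R n M (k.+1 - q)).

(** * Multivector fields *)

Definition multivector_field (R : realType) (n : nat) (M : charted R n)
  (q : nat) (U : M -> mvbundle M q) : Prop :=
  smooth_map U /\ forall x, mvproj (U x) = x.

Definition locally_hamiltonian (R : realType) (n k : nat) (M : charted R n)
  (q : nat) (w : dform M k.+1) (U : M -> mvbundle M q) : Prop :=
  closed_form (X := M) (p := k.+1 - q)
    (fun x => contract ((U x).2 : mvec R n q) (w x)).

(** * Lagrangian submanifolds *)

Definition orth (R : realType) (n m : nat) (eta : aform R n m.+1) (j : nat)
  (S : set 'rV[R]_n) : set 'rV[R]_n :=
  [set v | forall s : 'I_j -> 'rV[R]_n, (forall i, S (s i)) ->
           contract (wedge (vcons v s)) eta = 0].

Definition ker_flat1 (R : realType) (n m : nat) (eta : aform R n m.+1) :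
  set 'rV[R]_n := [set v | contract (wedge (fun _ : 'I_1 => v)) eta = 0].

Definition Lagrangian (R : realType) (n m : nat) (eta : aform R n m.+1)
  (j : nat) (S : set 'rV[R]_n) : Prop :=
  orth eta j S = [set s + z | s in S & z in ker_flat1 eta].

(* c belongs to the maximal atlas. *)
Definition compatible_chart (R : realType) (n : nat) (X : charted R n)
  (c : chart R n X) : Prop :=
  chart_wf c /\ forall c', atlas X c' ->
    smooth_transition c c' /\ smooth_transition c' c.

(* Embedded submanifold of dimension d, by slice charts. *)
Definition submanifold (R : realType) (n : nat) (X : charted R n) (d : nat)
  (S : set X) : Prop :=
  (d <= n)%N /\ forall x, S x -> exists c : chart R n X,
    [/\ compatible_chart c, cdom c x &
        cmap c @` (S `&` cdom c) =
        cimg c `&` [set y | forall i : 'I_n, (d <= i)%N -> y 0 i = 0]].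

(* Velocities at x of the smooth curves of X lying in S. *)
Definition tangent_space (R : realType) (n : nat) (X : charted R n)
  (S : set X) (x : X) : set 'rV[R]_n :=
  [set v | exists (e : R) (g : R -> X),
     [/\ 0 < e,
         forall t, `|t| < e -> S (g t) /\ cdom (chart_at x) (g t),
         g 0 = x,
         smooth_on (V := R^o) [set t | `|t| < e] (cmap (chart_at x) \o g) &
         v = derive1 (cmap (chart_at x) \o g) 0]].

Definition Lagrangian_submanifold (R : realType) (n m : nat) (X : charted R n)
  (eta : dform X m.+1) (j : nat) (S : set X) : Prop :=
  (exists d, submanifold d S) /\
  forall x, S x -> Lagrangian (eta x) j (tangent_space S x).

(* Main.v *)
(** Work in a chart y of M and let sigma = iota_U omega, a form of degree
    m = k+1-q.  In the induced chart of the bundle of m-forms, Theta at the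
    covector with components u over y sends (v_1, ..., v_m) to u applied to the
    horizontal parts of the v_i, so Omega(v_0, ..., v_m) is minus the
    alternating sum of the vertical part of v_i evaluated on the horizontal
    parts of the others.  Since flat o U is the graph of sigma, the pullback of
    Omega_tilde by U is - d sigma; hence U is locally Hamiltonian iff
    Omega_tilde vanishes on the tangent space S of the image at each point.

    Vanishing on S means that S is contained in its m-orthogonal.  It always
    implies that S is m-Lagrangian: a vector v of the m-orthogonal differs from
    a vector of S by a vertical vector, which is again in the m-orthogonal, and
    Omega_tilde with one vertical argument only depends on the horizontal parts
    of the other arguments, which can be realised in S; so that vertical vector
    is in the kernel.  The image is an embedded submanifold because shearing a
    bundle chart by the local expression of U makes it a slice chart. *)
Require Import Defs.
From HB Require Import structures.
From mathcomp Require Import all_boot all_order all_algebra all_fingroup.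
From mathcomp Require Import all_classical all_reals all_analysis.
(* [all_analysis] shadows the [contract] of Defs. *)
Import Defs.

Set Implicit Arguments.
Unset Strict Implicit.
Unset Printing Implicit Defensive.

Import Order.TTheory GRing.Theory Num.Theory.
Import numFieldNormedType.Exports.

Local Open Scope classical_set_scope.
Local Open Scope ring_scope.

(** * Multilinear alternating functions and forms *)

Definition upd (T : Type) (p : nat) (v : 'I_p -> T) (i : 'I_p) (x : T) :
  'I_p -> T := fun j => if j == i then x else v j.

(** Tuples stay plain functions, so linearity is stated slot by slot through [upd]. Alternation is
    vanishing on a repeated vector, from which [malt_tperm] derives antisymmetry. *)
Definition malt (R : realType) (n p : nat) (F : ('I_p -> 'rV[R]_n) -> R) :
  Prop :=
  (forall v i a x y, F (upd v i (a *: x + y)) =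
     a * F (upd v i x) + F (upd v i y)) /\
  (forall v i j, i != j -> v i = v j -> F v = 0).

Section Upd.
Variables (T : Type) (p : nat).
Implicit Types (v : 'I_p -> T).

Lemma upd_id v i : upd v i (v i) = v.
Proof. by apply/funext => j; rewrite /upd; case: eqP => [->|]. Qed.

Lemma updC v i j x y : i != j -> upd (upd v i x) j y = upd (upd v j y) i x.
Proof.
move=> ij; apply/funext => k; rewrite /upd.
case: (eqVneq k j) => // ->; by rewrite eq_sym (negbTE ij).
Qed.

Lemma upd_comp (T' : Type) (A : T -> T') v i x :
  A \o upd v i x = upd (A \o v) i (A x).
Proof. by apply/funext => k; rewrite /upd /=; case: eqP. Qed.
End Upd.

Section Malt.
Variables (R : realType) (n p : nat).
Implicit Types (F G : ('I_p -> 'rV[R]_n) -> R) (v : 'I_p -> 'rV[R]_n).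

Lemma malt_upd0 F v i : malt F -> F (upd v i 0) = 0.
Proof.
move=> [mF _]; have := mF v i (-1) 0 0.
by rewrite scaler0 addr0 mulN1r addNr.
Qed.

Lemma malt_updD F v i x y : malt F ->
  F (upd v i (x + y)) = F (upd v i x) + F (upd v i y).
Proof. by move=> [mF _]; rewrite -[x in LHS]scale1r mF mul1r. Qed.

Lemma malt_upd_sum F v i (I : Type) (r : seq I) (P : pred I) (c : I -> R)
    (x : I -> 'rV[R]_n) : malt F ->
  F (upd v i (\sum_(k <- r | P k) c k *: x k)) =
  \sum_(k <- r | P k) c k * F (upd v i (x k)).
Proof.
move=> mF; elim/big_rec2: _ => [|k y1 y2 _ IH]; first exact: malt_upd0.
by rewrite (proj1 mF) IH.
Qed.

Lemma malt_coord0 F v i : malt F -> v i = 0 -> F v = 0.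
Proof. by move=> mF vi; rewrite -(upd_id v i) vi malt_upd0. Qed.

(** Polarisation: [F] vanishes when [v i + v j] stands in both slots; expanding, the two diagonal
    terms vanish and the two mixed ones cancel. *)
Lemma malt_tperm F v i j : malt F -> i != j -> F (v \o tperm i j) = - F v.
Proof.
move=> mF ij; have [_ aF] := mF.
pose w x y := upd (upd v i x) j y.
have -> : v \o tperm i j = w (v j) (v i).
  apply/funext => k; rewrite /w /upd /=.
  case: tpermP => [->|->|/eqP/negbTE ki /eqP/negbTE ->]; last by rewrite ki.
    by rewrite (negbTE ij) eqxx.
  by rewrite eqxx.
have -> : F v = F (w (v i) (v j)).
  by congr F; rewrite /w !upd_id.
have w0 x : F (w x x) = 0.
  by apply: (aF _ i j ij); rewrite /w /upd eqxx (negbTE ij) eqxx.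
apply/eqP; rewrite -addr_eq0; apply/eqP.
have := w0 (v i + v j).
rewrite /w malt_updD // ![upd (upd v i _) j _]updC // !malt_updD //.
have ji : j != i by rewrite eq_sym.
rewrite -![upd (upd v j _) i _]updC //.
have := w0 (v i); have := w0 (v j); rewrite /w => -> ->.
by rewrite add0r addr0.
Qed.

(** Induction on a factorisation of [s] into transpositions, each contributing one sign. *)
Lemma malt_perm F v (s : 'S_p) : malt F -> F (v \o s) = (-1) ^+ s * F v.
Proof.
move=> mF; case: (prod_tpermP s) => ts -> dts.
rewrite odd_perm_prod //.
elim: ts dts v => [|t ts IH] /=.
  by move=> _ v; rewrite big_nil mul1r; congr F; apply/funext => k /=; rewrite perm1.
case/andP=> dt dts v; rewrite big_cons.
have -> : v \o (tperm t.1 t.2 * \prod_(t0 <- ts) tperm t0.1 t0.2)%g =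
   (v \o (\prod_(t0 <- ts) tperm t0.1 t0.2)%g) \o tperm t.1 t.2.
  by apply/funext => k /=; rewrite permM.
by rewrite malt_tperm // IH //= signrN mulNr.
Qed.

(* Increasing multi-indices suffice: an injective one can be sorted. *)
Lemma malt_ext F G : malt F -> malt G ->
  (forall J : midx n p, F (@basis_vec R n p J) = G (@basis_vec R n p J)) ->
  F =1 G.
Proof.
move=> mF mG FG.
have FGf (f : 'I_p -> 'I_n) : F (fun i => delta_mx 0 (f i)) =
    G (fun i => delta_mx 0 (f i)).
  have [finj|] := pselect (injective f); last first.
    move=> /existsNP[i /existsNP[j /not_implyP[fij /eqP ij]]].
    rewrite (proj2 mF _ i j) //= ?fij //.
    by rewrite (proj2 mG _ i j) //= ?fij.
  pose t := [tuple f i | i < p].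
  pose t' := sort_tuple <=%O t.
  have /tuple_permP[s st] : perm_eq t' t by rewrite perm_sort.
  have t's i : tnth t' i = f (s i).
    rewrite (tnth_nth (f i)) st -(tnth_nth _ [tuple tnth t (s i0) | i0 < p]).
    by rewrite !tnth_mktuple.
  have incJ : incr [ffun i => f (s i)].
    apply/forallP => i; apply/forallP => j; apply/implyP => ij.
    rewrite !ffunE -!t's ltn_neqAle; apply/andP; split.
      rewrite !t's; apply/eqP => /val_inj /finj /perm_inj e.
      by rewrite e ltnn in ij.
    have: (tnth t' i <= tnth t' j)%O; last by rewrite leEord.
    rewrite !(tnth_nth (f i)).
    apply: (sorted_leq_nth le_trans le_refl); rewrite ?inE ?size_tuple //.
    - exact: sort_le_sorted.
    - exact: ltnW.
  have := FG (exist (fun J => is_true (incr J)) _ incJ).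
  have -> : @basis_vec R n p (exist (fun J => is_true (incr J)) _ incJ) =
      (fun i => delta_mx 0 (f i)) \o s.
    by apply/funext => i; rewrite /basis_vec /= ffunE.
  by rewrite !malt_perm // => /(congr1 ( *%R ((-1) ^+ s))); rewrite !signrMK.
(* Induction on the number [k] of leading slots that may still hold arbitrary vectors; expanding
   slot [k] in the standard basis leads from [k.+1] to [k], and [k = 0] is the case [FGf]. *)
suff H k : (k <= p)%N -> forall v, (forall i : 'I_p, (k <= i)%N ->
    exists j, v i = delta_mx 0 j) -> F v = G v.
  by move=> v; apply: (H p) => // i; rewrite leqNgt ltn_ord.
elim: k => [_ v hv|k IH kp v hv].
  have /choice[f hf] : forall i, exists j, v i = delta_mx 0 j by move=> i; exact: hv.
  by have -> : v = fun i => delta_mx 0 (f i) by apply/funext.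
pose i := Ordinal kp.
rewrite -(upd_id v i) (row_sum_delta (v i)) !malt_upd_sum //.
apply: eq_bigr => j _; congr (_ * _); apply: IH; first exact: ltnW.
move=> l kl; rewrite /upd; case: eqP => [_|/eqP li]; first by exists j.
apply: hv; rewrite ltn_neqAle kl andbT eq_sym.
by apply: contraNneq li => ?; apply/eqP/val_inj.
Qed.
End Malt.

Section MaltClosure.
Variables (R : realType) (n : nat).

Lemma malt_comp (m p : nat) (A : 'rV[R]_n -> 'rV[R]_m)
    (F : ('I_p -> 'rV[R]_m) -> R) :
  linear A -> malt F -> malt (fun v => F (A \o v)).
Proof.
move=> lA [mF aF]; split=> [v i a x y|v i j ij vij].
  by rewrite !upd_comp lA mF.
by apply: (aF _ i j ij) => /=; rewrite vij.
Qed.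

Lemma malt_sum (p : nat) (I : finType) (c : I -> R)
    (F : I -> ('I_p -> 'rV[R]_n) -> R) :
  (forall k, malt (F k)) -> malt (fun v => \sum_k c k * F k v).
Proof.
move=> mF; split=> [v i a x y|v i j ij vij].
  rewrite mulr_sumr -big_split /=; apply: eq_bigr => k _.
  by rewrite (proj1 (mF k)) mulrDr mulrCA.
by apply: big1 => k _; rewrite (proj2 (mF k) v i j) // mulr0.
Qed.

(** Row [i] depends linearly on [v i] alone, and equal arguments give equal rows. Minors and the
    alternating sums of the exterior derivative are both reduced to this case. *)
Lemma malt_det (p : nat) (L : 'I_p -> 'rV[R]_n -> R) :
  (forall j, scalar (L j)) ->
  malt (fun v => \det (\matrix_(i < p, j < p) L j (v i))).
Proof.
move=> lL; split=> [v i a x y|v i j ij vij]; last first.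
  by apply: (determinant_alternate ij) => k; rewrite !mxE vij.
pose A z := \matrix_(k < p, j < p) L j (upd v i z k).
rewrite (@determinant_multilinear _ _ _ (A x) (A y) i a 1) ?mul1r //.
- by apply/rowP => k; rewrite !mxE /upd eqxx lL mul1r.
- by apply/matrixP => k l; rewrite !mxE /upd [lift _ _ == _]eq_sym (negbTE (neq_lift _ _)).
- by apply/matrixP => k l; rewrite !mxE /upd [lift _ _ == _]eq_sym (negbTE (neq_lift _ _)).
Qed.

Lemma malt_minor (p : nat) (J : midx n p) :
  malt (fun v : 'I_p -> 'rV[R]_n => minor v J).
Proof.
by apply: (@malt_det p (fun j x => x 0 (val J j))) => j a x y; rewrite !mxE.
Qed.

Lemma malt_feval (p : nat) (a : 'rV[R]_(extdim n p)) : malt (feval a).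
Proof. by apply: malt_sum => J; exact: malt_minor. Qed.

End MaltClosure.

(** * Coordinates with respect to increasing multi-indices *)

Section Basis.
Variables (R : realType) (n p : nat).
Implicit Types (I J : midx n p).

Lemma midx_lt I (i j : 'I_p) : (i < j)%N -> (val I i < val I j)%N.
Proof. by case: I => I /= /forallP/(_ i)/forallP/(_ j)/implyP; apply. Qed.

Lemma midx_inj I : injective (val I).
Proof.
move=> i j e; case: (ltngtP i j) => [/(midx_lt I)|/(midx_lt I)|/val_inj //].
  by rewrite e ltnn.
by rewrite e ltnn.
Qed.

(** Both indices list the same set of values in increasing order, and a strictly sorted sequence is
    determined by its elements. *)
Lemma midx_perm I J (s : 'S_p) : (forall i, val I i = val J (s i)) -> I = J.
Proof.
move=> IJ.
have srt (K : midx n p) : sorted <%O (map (val K) (enum 'I_p)).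
  have : sorted (relpre val ltn) (enum 'I_p).
    by rewrite -sorted_map val_enum_ord iota_ltn_sorted.
  move=> h; apply: (homo_sorted (f := val K) (e := relpre val ltn) (e' := <%O) _ _ h)
    => i j /= ij.
  exact: (midx_lt K ij).
have eIJ : map (val I) (enum 'I_p) = map (val J) (enum 'I_p).
  apply: lt_sorted_eq; [exact: srt|exact: srt|move=> x].
  apply/mapP/mapP => -[i _ ->].
    by exists (s i); rewrite ?mem_enum.
  by exists ((s^-1)%g i); rewrite ?mem_enum // IJ permKV.
apply/val_inj/ffunP => i.
have := congr1 (fun t => nth (val I i) t i) eIJ.
by rewrite !(nth_map i) -?enumT ?size_enum_ord // nth_ord_enum.
Qed.

(** Duality of the bases e_I and e^J. For distinct indices every term of the determinant has a zero
    factor: otherwise a permutation would carry [J] to [I], against [midx_perm]. *)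
Lemma minor_basis I J : minor (@basis_vec R n p I) J = (I == J)%:R.
Proof.
rewrite /minor; case: (eqVneq I J) => [->|IJ].
  rewrite -[RHS](det1 R p); congr (\det _); apply/matrixP => i j.
  by rewrite !mxE /= (inj_eq (@midx_inj J)) eq_sym.
apply: big1 => s _.
have [i hi] : exists i, val I i != val J (s i).
  apply/existsP; apply: contraNT IJ => /existsPn h.
  by apply/eqP/(@midx_perm _ _ s) => i; apply/eqP; rewrite -[_ == _]negbK h.
by rewrite (bigD1 i) //= !mxE eqxx eq_sym (negbTE hi) mul0r mulr0.
Qed.

Lemma coefE (F : midx n p -> R) J : coef (\row_K F (enum_val K)) J = F J.
Proof. by rewrite /coef mxE enum_rankK. Qed.

Lemma coef_inj (a b : 'rV[R]_(extdim n p)) : coef a =1 coef b -> a = b.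
Proof.
by move=> ab; apply/rowP => i; have := ab (enum_val i); rewrite /coef enum_valK.
Qed.

Lemma coef_mkform (F : ('I_p -> 'rV[R]_n) -> R) J :
  coef (mkform F) J = F (@basis_vec R n p J).
Proof. by rewrite /mkform (coefE (fun K => F (@basis_vec R n p K))). Qed.

Lemma coef_wedge (u : 'I_p -> 'rV[R]_n) J : coef (wedge u) J = minor u J.
Proof. by rewrite /wedge (coefE (minor u)). Qed.

Lemma feval_basis (a : 'rV[R]_(extdim n p)) J :
  feval a (@basis_vec R n p J) = coef a J.
Proof.
rewrite /feval (bigD1 J) //= minor_basis eqxx mulr1 big1 ?addr0 // => K KJ.
by rewrite minor_basis eq_sym (negbTE KJ) mulr0.
Qed.

(** [mkform] samples [F] on increasing basis tuples only; by [malt_ext] these samples determine a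
    multilinear alternating [F]. *)
Lemma feval_mkform (F : ('I_p -> 'rV[R]_n) -> R) : malt F ->
  feval (mkform F) =1 F.
Proof.
move=> mF; apply: malt_ext => // [|J]; first exact: malt_feval.
by rewrite feval_basis coef_mkform.
Qed.

(** A multilinear alternating [F] factors through the wedge of its arguments, whose coordinates are
    the minors. *)
Lemma malt_expand (F : ('I_p -> 'rV[R]_n) -> R) v : malt F ->
  F v = \sum_(J : midx n p) minor v J * F (@basis_vec R n p J).
Proof.
move=> mF; rewrite -(feval_mkform mF); apply: eq_bigr => J _.
by rewrite coef_mkform mulrC.
Qed.

Lemma feval_inj (a b : 'rV[R]_(extdim n p)) : feval a =1 feval b -> a = b.
Proof. by move=> ab; apply: coef_inj => J; rewrite -!feval_basis ab. Qed.

Lemma coef_linear J : scalar (fun a : 'rV[R]_(extdim n p) => coef a J).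
Proof. by move=> c a b; rewrite /coef !mxE. Qed.

Lemma feval_linear v : scalar (fun a : 'rV[R]_(extdim n p) => feval a v).
Proof.
move=> c a b; rewrite /feval mulr_sumr -big_split /=; apply: eq_bigr => J _.
by rewrite coef_linear mulrDl mulrA.
Qed.

Lemma fevalN (a : 'rV[R]_(extdim n p)) v : feval (- a) v = - feval a v.
Proof.
rewrite /feval -sumrN; apply: eq_bigr => J _.
by rewrite /coef mxE mulNr.
Qed.

Lemma feval0 v : feval (0 : 'rV[R]_(extdim n p)) v = 0.
Proof. by apply: big1 => J _; rewrite /coef mxE mul0r. Qed.
End Basis.

(** * Functoriality of pullback and pushforward *)

Section Pull.
Variables (R : realType).

Lemma feval_fpull (n m p : nat) (A : 'rV[R]_n -> 'rV[R]_m)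
    (a : 'rV[R]_(extdim m p)) v :
  linear A -> feval (fpull A a) v = feval a (A \o v).
Proof.
by move=> lA; rewrite feval_mkform //; apply: malt_comp => //; exact: malt_feval.
Qed.

Lemma coef_fpull (n m p : nat) (A : 'rV[R]_n -> 'rV[R]_m)
    (a : 'rV[R]_(extdim m p)) J :
  coef (fpull A a) J = feval a (A \o @basis_vec R n p J).
Proof. by rewrite coef_mkform. Qed.

Lemma fpull_comp (n m l p : nat) (A : 'rV[R]_n -> 'rV[R]_m)
    (B : 'rV[R]_m -> 'rV[R]_l) (a : 'rV[R]_(extdim l p)) :
  linear B -> fpull A (fpull B a) = fpull (B \o A) a.
Proof.
by move=> lB; apply: coef_inj => J; rewrite !coef_fpull feval_fpull.
Qed.

Lemma coef_mvpush (n m q : nat) (A : 'rV[R]_n -> 'rV[R]_m)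
    (u : 'rV[R]_(extdim n q)) J :
  coef (mvpush A u) J =
  \sum_(I : midx n q) coef u I * minor (A \o @basis_vec R n q I) J.
Proof.
rewrite /coef /mvpush summxE; apply: eq_bigr => I _.
by rewrite mxE -/(coef (wedge _) J) coef_wedge.
Qed.

(** Adjunction between pushforward of multivectors and precomposition: pairing [F] with A_* u is
    pairing F o A with u. Functoriality of [mvpush] and naturality of contraction both follow from
    it. *)
Lemma mvpush_pair (n m q : nat) (A : 'rV[R]_n -> 'rV[R]_m)
    (u : 'rV[R]_(extdim n q)) (F : ('I_q -> 'rV[R]_m) -> R) : malt F ->
  \sum_(J : midx m q) coef (mvpush A u) J * F (@basis_vec R m q J) =
  \sum_(I : midx n q) coef u I * F (A \o @basis_vec R n q I).
Proof.
move=> mF; under eq_bigr do rewrite coef_mvpush mulr_suml.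
rewrite exchange_big /=; apply: eq_bigr => I _.
rewrite [in RHS](malt_expand _ mF) mulr_sumr.
by apply: eq_bigr => J _; rewrite mulrA.
Qed.

Lemma mvpush_comp (n m l q : nat) (A : 'rV[R]_n -> 'rV[R]_m)
    (B : 'rV[R]_m -> 'rV[R]_l) (u : 'rV[R]_(extdim n q)) :
  linear B -> mvpush B (mvpush A u) = mvpush (B \o A) u.
Proof.
move=> lB; apply: coef_inj => J; rewrite !coef_mvpush.
rewrite (mvpush_pair A u (F := fun v => minor (B \o v) J)) //.
exact: (malt_comp lB (malt_minor R J)).
Qed.

Lemma mvpush_id (n q : nat) (u : 'rV[R]_(extdim n q)) : mvpush idfun u = u.
Proof.
apply: coef_inj => J; rewrite coef_mvpush (bigD1 J) //=.
rewrite minor_basis eqxx mulr1 big1 ?addr0 // => K KJ.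
by rewrite minor_basis (negbTE KJ) mulr0.
Qed.
End Pull.

(** * Concatenation of arguments and contraction *)

Section Vcat.
Variables (R : realType) (n q p : nat).
Implicit Types (u : 'I_q -> 'rV[R]_n) (v : 'I_(p - q) -> 'rV[R]_n).

Lemma vcatl u v (i : 'I_p) (a : 'I_q) : i = a :> nat -> vcat u v i = u a.
Proof. by rewrite /vcat => ->; rewrite valK. Qed.

Lemma vcatr u v (i : 'I_p) (b : 'I_(p - q)) :
  i = (q + b)%N :> nat -> vcat u v i = v b.
Proof.
by rewrite /vcat => ->; rewrite insubF ?ltnNge ?leq_addr // addKn valK.
Qed.

Lemma vcat_cases (i : 'I_p) :
  (exists a : 'I_q, i = a :> nat) \/ (exists b : 'I_(p - q), i = (q + b)%N :> nat).
Proof.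
have [iq|qi] := ltnP i q; first by left; exists (Ordinal iq).
have h : (i - q < p - q)%N by rewrite ltn_sub2r // (leq_ltn_trans qi).
by right; exists (Ordinal h); rewrite /= subnKC.
Qed.

End Vcat.

Section Contract.
Variables (R : realType) (n q p : nat).
Implicit Types (u : 'I_q -> 'rV[R]_n) (v : 'I_(p - q) -> 'rV[R]_n).

Lemma vcat_comp (m : nat) (A : 'rV[R]_n -> 'rV[R]_m) u v :
  A \o vcat u v = vcat (p := p) (A \o u) (A \o v).
Proof.
apply/funext => i /=; case: (vcat_cases q i) => [[a e]|[b e]].
  by rewrite !(vcatl _ _ e).
by rewrite !(vcatr _ _ e).
Qed.

Lemma malt_vcatr (F : ('I_p -> 'rV[R]_n) -> R) u :
  malt F -> malt (fun v => F (vcat u v)).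
Proof.
have hp (b : 'I_(p - q)) : (q + b < p)%N.
  by have := ltn_ord b; rewrite ltn_subRL.
(* [f b] is the slot of the concatenation that holds [v b]. *)
pose f b := Ordinal (hp b).
have hu v b x : vcat u (upd v b x) = upd (vcat u v) (f b) x.
  apply/funext => i; rewrite /upd.
  case: (vcat_cases q i) => [[a e]|[b' e]].
    rewrite !(vcatl _ _ e) ifF //; apply/negbTE/eqP => ei.
    by move: (ltn_ord a); rewrite -e ei /= ltnNge leq_addr.
  rewrite !(vcatr _ _ e); congr (if _ then _ else _).
  by rewrite -[RHS]val_eqE /= e eqn_add2l.
move=> [mF aF]; split=> [v i a x y|v i j ij vij]; first by rewrite !hu mF.
have vf b : vcat u v (f b) = v b by exact: vcatr.
apply: (aF _ (f i) (f j)); last by rewrite !vf.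
by rewrite -val_eqE /= eqn_add2l.
Qed.

Lemma malt_vcatl (F : ('I_p -> 'rV[R]_n) -> R) v :
  (q <= p)%N -> malt F -> malt (fun u => F (vcat u v)).
Proof.
move=> qp.
have hu u b x : vcat (upd u b x) v = upd (vcat u v) (widen_ord qp b) x.
  apply/funext => i; rewrite /upd.
  case: (vcat_cases q i) => [[a e]|[b' e]].
    rewrite !(vcatl _ _ e); congr (if _ then _ else _).
    by rewrite -[RHS]val_eqE /= e.
  rewrite !(vcatr _ _ e) ifF //; apply/negbTE/eqP => ei.
  by move: (ltn_ord b); have /= := congr1 val ei => <-; rewrite e ltnNge leq_addr.
move=> [mF aF]; split=> [u i a x y|u i j ij uij]; first by rewrite !hu mF.
have vf b : vcat u v (widen_ord qp b) = u b by exact: vcatl.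
by apply: (aF _ (widen_ord qp i) (widen_ord qp j)) => //; rewrite !vf.
Qed.

Lemma feval_contract (u : 'rV[R]_(extdim n q)) (a : 'rV[R]_(extdim n p)) v :
  feval (contract u a) v =
  \sum_(I : midx n q) coef u I * feval a (vcat (@basis_vec R n q I) v).
Proof.
rewrite feval_mkform //; apply: malt_sum => I.
by apply: malt_vcatr; exact: malt_feval.
Qed.

(** On a decomposable multivector the coordinates are minors, so the sum defining [contract] is the
    expansion of [feval a] in its first [q] arguments. *)
Lemma feval_contract_wedge u (a : 'rV[R]_(extdim n p)) v : (q <= p)%N ->
  feval (contract (wedge u) a) v = feval a (vcat u v).
Proof.
move=> qp; rewrite feval_contract.
rewrite [RHS](malt_expand u (malt_vcatl v qp (malt_feval a))).
by apply: eq_bigr => I _; rewrite coef_wedge.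
Qed.
End Contract.

(** Naturality of contraction; it will turn the chart expression of [flat] into a contraction of
    chart components. *)
Lemma fpull_contract (R : realType) (n m q p : nat)
    (A : 'rV[R]_n -> 'rV[R]_m) (u : 'rV[R]_(extdim n q))
    (a : 'rV[R]_(extdim m p)) : (q <= p)%N -> linear A ->
  fpull A (contract (mvpush A u) a) = contract u (fpull A a).
Proof.
move=> qp lA; apply: feval_inj => v; rewrite feval_fpull // !feval_contract.
rewrite (mvpush_pair A u (malt_vcatl _ qp (malt_feval a))).
by apply: eq_bigr => I _; rewrite feval_fpull // vcat_comp.
Qed.

(* Expansion of a determinant along the column of the [L (v i)]. *)
Lemma malt_extd (R : realType) (n m p : nat)
    (L : 'rV[R]_n -> 'rV[R]_(extdim m p)) (B : 'rV[R]_n -> 'rV[R]_m) :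
  linear L -> linear B ->
  malt (fun v : 'I_p.+1 -> 'rV[R]_n =>
    \sum_(i < p.+1) (-1) ^+ i * feval (L (v i)) (fun j => B (v (lift i j)))).
Proof.
move=> lL lB.
pose M (J : midx m p) (j : 'I_p.+1) (x : 'rV[R]_n) :=
  if unlift ord0 j is Some j' then B x 0 (val J j') else coef (L x) J.
suff -> : (fun v : 'I_p.+1 -> 'rV[R]_n =>
    \sum_(i < p.+1) (-1) ^+ i * feval (L (v i)) (fun j => B (v (lift i j)))) =
  (fun v => \sum_(J : midx m p) 1 *
     \det (\matrix_(i < p.+1, j < p.+1) M J j (v i))).
  apply: malt_sum => J; apply: malt_det => j a x y; rewrite /M.
  by case: unliftP => [j' _|_]; rewrite ?lB ?lL ?mxE // coef_linear.
apply/funext => v; under eq_bigr do rewrite mulr_sumr.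
rewrite exchange_big /=; apply: eq_bigr => J _.
rewrite mul1r (expand_det_col _ ord0); apply: eq_bigr => i _.
rewrite mulrCA mxE /M unlift_none; congr (_ * _).
rewrite /cofactor addn0; congr (_ * \det _).
by apply/matrixP => k l; rewrite !mxE liftK.
Qed.

(** * Functions of class C^k *)

Section NearEq.
Variables (R : realType) (V W : normedModType R).
Implicit Types (f g : V -> W) (x : V).

(** The zero map satisfies the expansion that characterises the differential, with a remainder that
    vanishes near 0; uniqueness identifies it with ['d f x]. *)
Lemma near_zero_diff f x : (\forall y \near x, f y = 0) ->
  differentiable f x /\ ('d f x = cst 0 :> (V -> W)).
Proof.
move=> f0.
have fx : f x = 0 by exact: nbhs_singleton f0.
have h : f \o shift x = cst (f x) + (\0 : V -> W) +o_ 0 id.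
  apply/eqaddoP => e e0.
  have : \forall y \near 0, f (y + x) = 0.
    by move: f0; rewrite (near_shift 0) subr0.
  apply: filterS => y fy; rewrite !fctE /= fy fx.
  by rewrite addr0 subr0 normr0 mulr_ge0 // ltW.
have e : 'd f x = (\0 : V -> W) :> (V -> W).
  by apply: diff_unique h => //; exact: cst_continuous.
split; last by rewrite e.
by apply/diff_locallyP; rewrite e; split => //; exact: cst_continuous.
Qed.

(** Locality of the differential, by applying the previous lemma to [g - f]. Chart expressions agree
    with their explicit formulas only on open sets, so this is used throughout. *)
Lemma near_eq_diff f g x : (\forall y \near x, f y = g y) ->
  differentiable f x -> differentiable g x /\ ('d g x = 'd f x :> (V -> W)).
Proof.
move=> fg df.
have [dh eh] : differentiable (g - f) x /\ ('d (g - f) x = cst 0 :> (V -> W)).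
  by apply: near_zero_diff; apply: filterS fg => y e; rewrite !fctE e subrr.
have -> : g = f + (g - f) by rewrite addrC subrK.
split; first exact: differentiableD.
by rewrite diffD // eh; apply/funext => v /=; rewrite addr0.
Qed.
End NearEq.

Section RowDiff.
Variables (R : realType).

Lemma differentiable_row (V : normedModType R) n (f : V -> 'rV[R]_n) x :
  (forall j, differentiable (fun y => f y 0 j : R) x) -> differentiable f x.
Proof.
move=> df; have -> : f = \sum_(j < n) (fun y => f y 0 j *: delta_mx 0 j).
  by apply/funext => y; rewrite fct_sumE; exact: row_sum_delta.
by apply: differentiable_sum => j; exact: differentiableZl.
Qed.

Lemma continuous_row (T : topologicalType) n (f : T -> 'rV[R]_n) x :
  (forall j, {for x, continuous (fun y => f y 0 j : R)}) -> {for x, continuous f}.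
Proof.
move=> cf; have -> : f = \sum_(j < n) (fun y => f y 0 j *: delta_mx 0 j).
  by apply/funext => y; rewrite fct_sumE; exact: row_sum_delta.
elim/big_ind: _ => [|g h cg ch|j _]; first exact: cst_continuous.
  exact: continuousD.
apply: continuousZr_tmp; exact: cf.
Qed.

(** Finite dimension supplies continuity: [f] is a finite sum of coordinate functions times fixed
    vectors. *)
Lemma linear_row_diff n (W : normedModType R) (f : {linear 'rV[R]_n -> W}) x :
  differentiable f x /\ 'd f x = f :> (_ -> _).
Proof.
suff df y : differentiable f y.
  by split => //; apply: diff_lin => y; exact: differentiable_continuous.
have e : \sum_(j < n) (fun y : 'rV[R]_n => y 0 j *: f (delta_mx 0 j)) = f.
  apply/funext => z; rewrite fct_sumE {2}(row_sum_delta z) linear_sum.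
  by apply: eq_bigr => j _; rewrite linearZ.
rewrite -e; apply: differentiable_sum => j; apply: differentiableZl.
exact: differentiable_coord.
Qed.

Lemma diff_coord (V : normedModType R) n (f : V -> 'rV[R]_n) x v j :
  differentiable f x -> ('D_v f x) 0 j = 'D_v (fun y => f y 0 j : R) x.
Proof.
by move=> df; rewrite derive_mx ?mxE //; exact: diff_derivable.
Qed.

Lemma differentiable_coordf (V : normedModType R) n (f : V -> 'rV[R]_n) x j :
  differentiable f x -> differentiable (fun y => f y 0 j : R) x.
Proof.
by move=> df; exact: (differentiable_comp df (differentiable_coord (f x) 0 j)).
Qed.
End RowDiff.

(** * Closure properties of the class C^k *)

Section Cn.
Variables (R : realType) (V : normedModType R).
Implicit Types (A B : set V) (k : nat).

Lemma Cn_on_diff (W : normedModType R) k A (f : V -> W) x :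
  Cn_on k.+1 A f -> A x -> differentiable f x.
Proof. by case=> df _; exact: df. Qed.

Lemma Cn_onS (W : normedModType R) k A (f : V -> W) :
  Cn_on k.+1 A f -> Cn_on k A f.
Proof.
elim: k f => [|k IH] f [df Df]; last by split => // v; exact: IH.
by move=> x Ax; apply: differentiable_continuous; exact: df.
Qed.

Lemma sub_Cn_on (W : normedModType R) k A B (f : V -> W) :
  B `<=` A -> Cn_on k A f -> Cn_on k B f.
Proof.
move=> BA; elim: k f => [|k IH] f /=; first by move=> cf x /BA; exact: cf.
by case=> df Df; split=> [x /BA|v]; [exact: df|exact: IH].
Qed.

Lemma near_open A x (P : V -> Prop) : open A -> A x ->
  (forall y, A y -> P y) -> \forall y \near x, P y.
Proof.
by move=> oA Ax AP; apply: (filterS AP); exact: open_nbhs_nbhs.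
Qed.

(** Openness turns equality on [A] into equality near each point of [A], so the directional
    derivatives again agree on [A] and the induction goes through. *)
Lemma eq_Cn_on (W : normedModType R) k A (f g : V -> W) : open A ->
  (forall x, A x -> f x = g x) -> Cn_on k A f -> Cn_on k A g.
Proof.
move=> oA; elim: k f g => [|k IH] f g fg /=.
  move=> cf x Ax; rewrite /prop_for /continuous_at -fg //.
  apply: cvg_trans (cf x Ax); apply: near_eq_cvg.
  by apply: (near_open oA Ax) => y Ay; rewrite fg.
have nfg x : A x -> \forall y \near x, f y = g y by move=> Ax; exact: near_open fg.
case=> df Df; split=> [x Ax|v].
  by have [] := near_eq_diff (nfg x Ax) (df x Ax).
by apply: IH (Df v) => x Ax; exact/near_eq_derive/nfg.
Qed.

Lemma Cn_on_cst (W : normedModType R) k A (a : W) : Cn_on k A (cst a).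
Proof.
elim: k a => [|k IH] a /=; first by move=> x _; exact: cst_continuous.
split=> [x _|v]; first exact: differentiable_cst.
have -> : 'D_v (cst a) = cst 0 :> (V -> W) by apply/funext => x; rewrite derive_cst.
exact: IH.
Qed.

Lemma Cn_onD (W : normedModType R) k A (f g : V -> W) : open A ->
  Cn_on k A f -> Cn_on k A g -> Cn_on k A (fun x => f x + g x).
Proof.
move=> oA; elim: k f g => [|k IH] f g /=.
  by move=> cf cg x Ax; apply: continuousD; [exact: cf|exact: cg].
case=> df Df [dg Dg]; split=> [x Ax|v].
  by apply: differentiableD; [exact: df|exact: dg].
apply: (eq_Cn_on oA _ (IH _ _ (Df v) (Dg v))) => x Ax.
by apply/esym/deriveD; apply: diff_derivable; [exact: df|exact: dg].
Qed.

Lemma Cn_on_sum (W : normedModType R) k A (I : Type) (r : seq I) (P : pred I)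
    (f : I -> V -> W) : open A -> (forall i, Cn_on k A (f i)) ->
  Cn_on k A (fun x => \sum_(i <- r | P i) f i x).
Proof.
move=> oA Cf; elim: r => [|i r IH].
  by apply: (eq_Cn_on oA _ (Cn_on_cst k A 0)) => x _; rewrite big_nil.
have [Pi|nPi] := boolP (P i).
  apply: (eq_Cn_on oA _ (Cn_onD oA (Cf i) IH)) => x _.
  by rewrite big_cons Pi.
by apply: (eq_Cn_on oA _ IH) => x _; rewrite big_cons (negbTE nPi).
Qed.

Lemma Cn_onM k A (f g : V -> R) : open A ->
  Cn_on k A f -> Cn_on k A g -> Cn_on k A (fun x => f x * g x).
Proof.
move=> oA; elim: k f g => [|k IH] f g.
  by move=> cf cg x Ax; apply: continuousM; [exact: cf|exact: cg].
move=> Cf Cg; have [df Df] := Cf; have [dg Dg] := Cg.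
split=> [x Ax|v].
  by apply: differentiableM; [exact: df|exact: dg].
(* The Leibniz rule pairs a derivative with an undifferentiated factor, and [Cn_onS] lowers the
   order of the latter to match. *)
apply: (eq_Cn_on oA _ (Cn_onD oA (IH _ _ (Cn_onS Cf) (Dg v))
  (IH _ _ (Cn_onS Cg) (Df v)))) => x Ax.
by apply/esym/deriveM; apply: diff_derivable; [exact: df|exact: dg].
Qed.

Lemma Cn_on_prod k A (I : Type) (r : seq I) (P : pred I)
    (f : I -> V -> R) : open A -> (forall i, Cn_on k A (f i)) ->
  Cn_on k A (fun x => \prod_(i <- r | P i) f i x).
Proof.
move=> oA Cf; elim: r => [|i r IH].
  by apply: (eq_Cn_on oA _ (Cn_on_cst k A (1 : R))) => x _; rewrite big_nil.
have [Pi|nPi] := boolP (P i).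
  apply: (eq_Cn_on oA _ (Cn_onM oA (Cf i) IH)) => x _.
  by rewrite big_cons Pi.
by apply: (eq_Cn_on oA _ IH) => x _; rewrite big_cons (negbTE nPi).
Qed.

Lemma Cn_on_det k A n (M : V -> 'M[R]_n) : open A ->
  (forall i j, Cn_on k A (fun x => M x i j)) -> Cn_on k A (fun x => \det (M x)).
Proof.
move=> oA CM; apply: Cn_on_sum => // s; apply: Cn_onM => //.
  exact: Cn_on_cst.
by apply: Cn_on_prod.
Qed.

Lemma Cn_on_coord k A n (f : V -> 'rV[R]_n) j : open A ->
  Cn_on k A f -> Cn_on k A (fun x => f x 0 j : R).
Proof.
move=> oA; elim: k f => [|k IH] f /=.
  move=> cf x Ax; exact: (continuous_comp (cf x Ax) (@coord_continuous R 1 n 0 j (f x))).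
case=> df Df; split=> [x Ax|v]; first exact/differentiable_coordf/df.
by apply: (eq_Cn_on oA _ (IH _ (Df v))) => x Ax; rewrite diff_coord //; exact: df.
Qed.

Lemma Cn_on_row k A n (f : V -> 'rV[R]_n) : open A ->
  (forall j, Cn_on k A (fun x => f x 0 j : R)) -> Cn_on k A f.
Proof.
move=> oA; elim: k f => [|k IH] f /=.
  by move=> cf x Ax; apply: continuous_row => j; exact: cf.
move=> Cf.
have df x : A x -> differentiable f x.
  by move=> Ax; apply: differentiable_row => j; have [dfj _] := Cf j; exact: dfj.
split=> // v; apply: IH => j; have [_ Df] := Cf j.
by apply: (eq_Cn_on oA _ (Df v)) => x Ax; rewrite diff_coord //; exact: df.
Qed.

Lemma Cn_on_row_mx k A n1 n2 (f : V -> 'rV[R]_n1) (g : V -> 'rV[R]_n2) : open A ->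
  Cn_on k A f -> Cn_on k A g -> Cn_on k A (fun x => row_mx (f x) (g x)).
Proof.
move=> oA Cf Cg; apply: Cn_on_row => // j; rewrite -(splitK j).
case: (fintype.split j) => i /=.
  have := Cn_on_coord i oA Cf.
  by apply: eq_Cn_on => // x _; rewrite row_mxEl.
have := Cn_on_coord i oA Cg.
by apply: eq_Cn_on => // x _; rewrite row_mxEr.
Qed.
End Cn.

Lemma Cn_on_linear (R : realType) n (W : normedModType R) k
    (A : set 'rV[R]_n) (f : {linear 'rV[R]_n -> W}) : Cn_on k A f.
Proof.
case: k => [|k] /=.
  move=> x _; apply: differentiable_continuous; exact: (linear_row_diff f x).1.
split=> [x _|v]; first exact: (linear_row_diff f x).1.
have -> : 'D_v f = cst (f v) :> (_ -> _).
  apply/funext => x; rewrite deriveE; last exact: (linear_row_diff f x).1.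
  by rewrite (linear_row_diff f x).2.
exact: Cn_on_cst.
Qed.

(** The chain rule through partial derivatives of [g]: [Cn_on] only speaks of derivatives along
    constant directions, whereas ['D_v f x] varies with [x]. *)
Lemma derive_comp_row (R : realType) (V W : normedModType R) m
    (f : V -> 'rV[R]_m) (g : 'rV[R]_m -> W) x v :
  differentiable f x -> differentiable g (f x) ->
  'D_v (g \o f) x = \sum_i ('D_v f x) 0 i *: 'D_(delta_mx 0 i) g (f x).
Proof.
move=> df dg; rewrite deriveE; last exact: differentiable_comp.
rewrite diff_comp //=; have -> : 'd f x v = 'D_v f x by rewrite deriveE.
rewrite {1}(row_sum_delta ('D_v f x)) linear_sum.
by apply: eq_bigr => i _; rewrite linearZ /= -deriveE.
Qed.

Lemma Cn_on_comp (R : realType) (V : normedModType R) m n k (A : set V)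
    (B : set 'rV[R]_m) (f : V -> 'rV[R]_m) (g : 'rV[R]_m -> 'rV[R]_n) :
  open A -> (forall x, A x -> B (f x)) ->
  Cn_on k A f -> Cn_on k B g -> Cn_on k A (g \o f).
Proof.
move=> oA AB; elim: k f g AB => [|k IH] f g AB Cf Cg.
  by move=> x Ax; apply: continuous_comp; [exact: Cf|exact/Cg/AB].
have [df Df] := Cf; have [dg Dg] := Cg.
split=> [x Ax|v]; first by apply: differentiable_comp; [exact: df|exact/dg/AB].
(* In coordinates the scalings of the chain rule become products of real functions, within reach of
   [Cn_onM]; the induction hypothesis handles the partial derivatives of [g] composed with [f]. *)
apply: Cn_on_row => // j.
apply: (@eq_Cn_on _ _ _ _ _ (fun x => \sum_i ('D_v f x) 0 i *
    ('D_(delta_mx 0 i) g \o f) x 0 j)) => // [x Ax|].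
  rewrite derive_comp_row; [|exact: df|exact/dg/AB].
  by rewrite summxE; apply: eq_bigr => i _; rewrite mxE.
apply: Cn_on_sum => // i; apply: Cn_onM => //.
  by apply: Cn_on_coord => //; exact: Df.
apply: Cn_on_coord => //.
exact: (IH _ _ AB (Cn_onS Cf) (Dg _)).
Qed.

Lemma smooth_on_diff (R : realType) (V W : normedModType R) (A : set V)
  (f : V -> W) x : smooth_on A f -> A x -> differentiable f x.
Proof. by move=> sf; exact: Cn_on_diff (sf 1%N). Qed.

(** * Transition maps *)

Lemma linear_diff (R : realType) n (W : normedModType R) (f : 'rV[R]_n -> W) x :
  linear f -> differentiable f x /\ 'd f x = f :> (_ -> _).
Proof.
move=> lf; pose fM := GRing.isLinear.Build R _ _ _ f lf.
pose fL : {linear 'rV[R]_n -> W} := HB.pack f fM.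
exact: (linear_row_diff fL x).
Qed.

Lemma diff_linear (R : realType) (V W : normedModType R) (f : V -> W) x :
  linear ('d f x).
Proof. by move=> a u v; rewrite linearP. Qed.

Lemma fpull_linear (R : realType) (n m p : nat) (A : 'rV[R]_n -> 'rV[R]_m) :
  linear (@fpull R n m p A).
Proof.
move=> a x y; apply: coef_inj => J.
by rewrite coef_linear !coef_fpull feval_linear.
Qed.

(** * Smooth dependence of the fibre maps on the base point *)

Section SmoothFibre.
Variables (R : realType) (V : normedModType R) (n : nat).
Variables (k : nat) (A : set V) (P : set 'rV[R]_n).
Variables (tau : 'rV[R]_n -> 'rV[R]_n) (f : V -> 'rV[R]_n).
Hypotheses (oA : open A) (AP : forall x, A x -> P (f x)).
Hypotheses (stau : smooth_on P tau) (Cf : Cn_on k A f).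

(** One order of differentiability of [tau] is spent on its Jacobian, hence the instance of [stau]
    at [k.+1]. *)
Lemma Cn_on_jac v j : Cn_on k A (fun x => ('d tau (f x) v) 0 j : R).
Proof.
have : Cn_on k A ('D_v tau \o f).
  by apply: (Cn_on_comp oA AP Cf); have [_] := stau k.+1; exact.
move=> /(Cn_on_coord j oA); apply: eq_Cn_on => // x Ax /=.
by rewrite deriveE //; exact/(smooth_on_diff stau)/AP.
Qed.

Lemma Cn_on_mvpush q (u : V -> 'rV[R]_(extdim n q)) : Cn_on k A u ->
  Cn_on k A (fun x => mvpush ('d tau (f x)) (u x)).
Proof.
move=> Cu; apply: Cn_on_row => // j.
apply: (@eq_Cn_on _ _ _ _ _ (fun x => \sum_(I : midx n q) coef (u x) I *
    minor ('d tau (f x) \o @basis_vec R n q I) (enum_val j))) => // [x Ax|].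
  by rewrite -coef_mvpush /coef enum_valK.
apply: Cn_on_sum => // I; apply: Cn_onM => //; first exact: Cn_on_coord.
apply: Cn_on_det => // i l.
have := @Cn_on_jac (delta_mx 0 (val I i)) (val (enum_val j) l).
by apply: eq_Cn_on => // x Ax; rewrite mxE.
Qed.

Lemma Cn_on_fpull q (u : V -> 'rV[R]_(extdim n q)) : Cn_on k A u ->
  Cn_on k A (fun x => fpull ('d tau (f x)) (u x)).
Proof.
move=> Cu; apply: Cn_on_row => // j.
apply: (@eq_Cn_on _ _ _ _ _ (fun x => \sum_(J : midx n q) coef (u x) J *
    minor ('d tau (f x) \o @basis_vec R n q (enum_val j)) J)) => // [x Ax|].
  by rewrite -/(feval _ _) -coef_fpull /coef enum_valK.
apply: Cn_on_sum => // I; apply: Cn_onM => //; first exact: Cn_on_coord.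
apply: Cn_on_det => // i l.
have := @Cn_on_jac (delta_mx 0 (val (enum_val j) i)) (val I l).
by apply: eq_Cn_on => // x Ax; rewrite mxE.
Qed.
End SmoothFibre.

Lemma Cn_on_contract (R : realType) (V : normedModType R) (n q p k : nat)
    (A : set V) (u : V -> 'rV[R]_(extdim n q)) (a : V -> 'rV[R]_(extdim n p)) :
  open A -> Cn_on k A u -> Cn_on k A a ->
  Cn_on k A (fun x => contract (u x) (a x)).
Proof.
move=> oA Cu Ca; apply: Cn_on_row => // j.
pose K := enum_val j.
apply: (@eq_Cn_on _ _ _ _ _ (fun x => \sum_(I : midx n q) coef (u x) I *
    feval (a x) (vcat (@basis_vec R n q I) (@basis_vec R n _ K)))) => // [x Ax|].
  by rewrite mxE.
apply: Cn_on_sum => // I; apply: Cn_onM => //; first exact: Cn_on_coord.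
apply: Cn_on_sum => // J; apply: Cn_onM => //; first exact: Cn_on_coord.
exact: Cn_on_cst.
Qed.

(** * Charts and the Jacobians of their transition maps *)

Section Manifold.
Variables (R : realType) (n : nat) (M : charted R n) (hM : is_manifold M).
Implicit Types (c b d : chart R n M) (x : M).

Lemma atlas_at x : atlas M (chart_at x).
Proof. by case: (manifold_chart_at hM x). Qed.

Lemma dom_at x : cdom (chart_at x) x.
Proof. by case: (manifold_chart_at hM x). Qed.

Lemma cmapK c x : atlas M c -> cdom c x -> cinv c (cmap c x) = x.
Proof. by move=> ac; have [_] := manifold_wf hM ac; apply. Qed.

Lemma cinvK c y : atlas M c -> cimg c y ->
  cdom c (cinv c y) /\ cmap c (cinv c y) = y.
Proof. by move=> ac [x cx <-]; rewrite cmapK. Qed.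

Lemma open_cimg c : atlas M c -> open (cimg c).
Proof. by move=> ac; have [] := manifold_wf hM ac. Qed.

Definition overlap c b : set 'rV[R]_n := cmap c @` (cdom c `&` cdom b).

Lemma open_overlap c b : atlas M c -> atlas M b -> open (overlap c b).
Proof. by move=> ac ab; have [] := manifold_transition hM ac ab. Qed.

Lemma smooth_trans c b : atlas M c -> atlas M b ->
  smooth_on (overlap c b) (cmap b \o cinv c).
Proof. by move=> ac ab; have [] := manifold_transition hM ac ab. Qed.

Lemma overlap_map c b x : cdom c x -> cdom b x -> overlap c b (cmap c x).
Proof. by move=> cx bx; exists x. Qed.

Lemma overlapP c b y : atlas M c -> overlap c b y ->
  [/\ cdom c (cinv c y), cdom b (cinv c y) & cmap c (cinv c y) = y].
Proof. by move=> ac [x [cx bx] <-]; rewrite cmapK. Qed.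

(* [tcoord c x] and [tvec c x] are the instances from and to [chart_at x],
   by conversion. *)
Definition tjac c b x : 'rV[R]_n -> 'rV[R]_n := 'd (cmap b \o cinv c) (cmap c x).

Lemma trans_diff c b x : atlas M c -> atlas M b -> cdom c x -> cdom b x ->
  differentiable (cmap b \o cinv c) (cmap c x).
Proof.
by move=> ac ab cx bx; exact: (smooth_on_diff (smooth_trans ac ab) (overlap_map cx bx)).
Qed.

(** The cocycle identity. The composite of transitions equals the direct one only on the overlap of
    [c] and [b], so locality of the differential joins the chain rule. *)
Lemma tjac_comp c b d x : atlas M c -> atlas M b -> atlas M d ->
  cdom c x -> cdom b x -> cdom d x -> tjac b d x \o tjac c b x = tjac c d x.
Proof.
move=> ac ab ad cx bx dx.
have e : (cmap b \o cinv c) (cmap c x) = cmap b x by rewrite /= cmapK.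
have dbc := trans_diff ac ab cx bx.
have dbd : differentiable (cmap d \o cinv b) ((cmap b \o cinv c) (cmap c x)).
  by rewrite e; exact: trans_diff.
have -> : tjac b d x = 'd (cmap d \o cinv b) ((cmap b \o cinv c) (cmap c x)).
  by rewrite e.
rewrite /tjac -(diff_comp dbc dbd).
apply: (near_eq_diff _ (trans_diff ac ad cx dx)).2.
apply: (near_open (open_overlap ac ab) (overlap_map cx bx)) => y /(overlapP ac).
by case=> h1 h2 h3 /=; rewrite cmapK.
Qed.

Lemma tjac_id c x : atlas M c -> cdom c x -> tjac c c x = idfun.
Proof.
move=> ac cx; rewrite /tjac.
have [did eid] := @linear_diff R n _ idfun (cmap c x) (fun _ _ _ => erefl).
rewrite -[in RHS]eid; apply: (near_eq_diff _ _).2 => //.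
apply: (near_open (open_cimg ac)); first by exists x.
by move=> y /(cinvK ac)[_] /=.
Qed.

(** When one chart is [chart_at x], this says that [tcoord] and [tvec] are mutually inverse. *)
Lemma tjacK c b x : atlas M c -> atlas M b -> cdom c x -> cdom b x ->
  tjac b c x \o tjac c b x = idfun.
Proof. by move=> ac ab cx bx; rewrite tjac_comp // tjac_id. Qed.

Lemma tcoord_linear c x : linear (tcoord c x). Proof. exact: diff_linear. Qed.
Lemma tvec_linear c x : linear (tvec c x). Proof. exact: diff_linear. Qed.

(** The part of the coordinate space of a bundle lying above [P]: images and overlaps of bundle
    charts have this shape. *)
Definition over N (P : set 'rV[R]_n) : set 'rV[R]_(n + N) := lsubmx @^-1` P.

Lemma overE N (P : set 'rV[R]_n) (y : 'rV[R]_(n + N)) :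
  over P y = P (lsubmx y).
Proof. by []. Qed.

Lemma open_over N P : open P -> open (@over N P).
Proof.
move=> oP; apply: open_comp => // x _; exact: continuous_lsubmx.
Qed.

End Manifold.

(** * The canonical form in bundle charts *)

Section FormBundle.
Variables (R : realType) (n m : nat) (M : charted R n) (hM : is_manifold M).
Implicit Types (c b d : chart R n M).

Definition formchart c : chart R (n + extdim n m) (formbundle M m) :=
  bundle_chart (fun _ A' => @fpull R n n m A') c.

(** The passage through the frame of [chart_at x] cancels by the cocycle identity. Forms are
    contravariant, so the Jacobian is the one from [b] back to [c]. *)
Lemma formchart_trans c b y : atlas M c -> atlas M b ->
  over (overlap c b) y ->
  (cmap (formchart b) \o cinv (formchart c)) y =
  row_mx ((cmap b \o cinv c) (lsubmx y))
    (fpull ('d (cmap c \o cinv b) ((cmap b \o cinv c) (lsubmx y))) (rsubmx y)).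
Proof.
move=> ac ab /(overlapP hM ac)[cx bx e] /=; set x := cinv c _.
apply: (congr1 (row_mx _)).
apply: (etrans (fpull_comp _ _ (tcoord_linear c x))).
apply: (congr1 (fun A => fpull A (rsubmx y))).
exact: (tjac_comp hM ab (atlas_at hM x) ac bx (dom_at hM x) cx).
Qed.

Lemma diff_formchart_trans c b y : atlas M c -> atlas M b ->
  over (overlap c b) y -> differentiable (cmap (formchart b) \o cinv (formchart c)) y.
Proof.
move=> ac ab py.
have oA := open_over (N := extdim n m) (open_overlap hM ac ab).
have Cl : Cn_on 1 (over (N := extdim n m) (overlap c b))
    (fun y => (cmap b \o cinv c) (lsubmx y)).
  apply: (Cn_on_comp (B := overlap c b) (f := lsubmx) (g := cmap b \o cinv c)) => //.
    exact: Cn_on_linear.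
  exact: smooth_trans.
suff H : Cn_on 1 (over (overlap c b)) (cmap (formchart b) \o cinv (formchart c)).
  exact: (Cn_on_diff H py).
apply: (eq_Cn_on oA) => [z pz|]; first by apply/esym; exact: formchart_trans.
apply: Cn_on_row_mx => //.
apply: (Cn_on_fpull (P := overlap b c)) => //.
- by move=> z /(overlapP hM ac)[cx bx e]; exact: overlap_map.
- exact: smooth_trans.
- exact: Cn_on_linear.
Qed.

(** The bundle chart at [z] is induced by the base chart at [z.1], so in these charts the projection
    is, near [z], the projection to base coordinates. *)
Lemma tmap_formproj (z : formbundle M m) :
  tmap (@formproj R n M m) z = lsubmx :> (_ -> _).
Proof.
have [_ <-] := @linear_diff R _ _ (lsubmx : 'rV[R]_(n + extdim n m) -> 'rV_n)
  (cmap (chart_at z) z) (fun a u v => linearP _ _ _ _).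
apply: (near_eq_diff _ _).2; last exact: differentiable_lsubmx.
have oc := open_cimg hM (atlas_at hM z.1).
apply: (near_open (open_over (N := extdim n m) oc)).
  by rewrite /over /= row_mxKl; exists z.1 => //; exact: dom_at.
by move=> y /(cinvK hM (atlas_at hM z.1))[_] /=.
Qed.

(** A transition of the bundle covers one of the base; differentiating this, horizontal parts
    transform as tangent vectors of the base. *)
Lemma tvec_formchart c (z : formbundle M m) v : atlas M c -> cdom c z.1 ->
  lsubmx (tvec (formchart c) z v) = tvec c z.1 (lsubmx v).
Proof.
move=> ac cz; have az := atlas_at hM z.1; have dz := dom_at hM z.1.
have hl : lsubmx (cmap (formchart c) z) = cmap c z.1 by exact: row_mxKl.
have df : differentiable (cmap (chart_at z) \o cinv (formchart c))
    (cmap (formchart c) z).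
  by apply: diff_formchart_trans => //; rewrite /over /= hl; exact: overlap_map.
have dl w : differentiable (lsubmx : 'rV[R]_(n + extdim n m) -> 'rV_n) w.
  exact: differentiable_lsubmx.
have el w : 'd (lsubmx : 'rV[R]_(n + extdim n m) -> 'rV_n) w = lsubmx :> (_ -> _).
  by apply: (linear_diff _ _).2 => a x y; rewrite linearP.
have dt : differentiable (cmap (chart_at z.1) \o cinv c)
    (lsubmx (cmap (formchart c) z)).
  by rewrite hl; exact: (trans_diff hM).
have -> : tvec c z.1 (lsubmx v) =
    'd ((cmap (chart_at z.1) \o cinv c) \o lsubmx) (cmap (formchart c) z) v.
  by rewrite (diff_comp (dl _) dt) /= el hl.
transitivity ('d (lsubmx \o (cmap (chart_at z) \o cinv (formchart c)))
    (cmap (formchart c) z) v).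
  by rewrite (diff_comp df (dl _)) /= el.
congr ('d _ _ v); apply/funext => y /=; exact: row_mxKl.
Qed.

(** The tautological expression \sum_J p_J dx^J: the frame change in the fibre cancels the one on
    horizontal parts. *)
Lemma localform_Theta c y : atlas M c -> over (cimg c) y ->
  localform (@Theta R n M m) (formchart c) y = fpull lsubmx (rsubmx y).
Proof.
move=> ac /(cinvK hM ac)[cx e].
pose z := cinv (formchart c) y; pose x := cinv c (lsubmx y).
have ax := atlas_at hM x; have dx := dom_at hM x.
transitivity (fpull (tvec (formchart c) z)
   (fpull (tmap (@formproj R n M m) z) (fpull (tcoord c x) (rsubmx y)))) => //.
rewrite tmap_formproj !fpull_comp; try exact: tcoord_linear.
  congr fpull; apply/funext => v /=; rewrite tvec_formchart //.
  have := congr1 (fun f => f (lsubmx v)) (tjacK hM ac ax cx dx).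
  by [].
by move=> a u v; rewrite linearP.
Qed.

(** In the chart at [z] the form [Theta] is linear in the point, so its derivative in a direction is
    its value on that direction. *)
Lemma Omega_eval (z : formbundle M m) (v : 'I_m.+1 -> 'rV[R]_(n + extdim n m)) :
  feval (@Omega R n M m z) v =
  - \sum_(i < m.+1) (-1) ^+ i *
      feval (rsubmx (v i)) (fun j => lsubmx (v (lift i j))).
Proof.
have ll (k : nat) : linear (lsubmx : 'rV[R]_(n + k) -> 'rV_n).
  by move=> a x y; rewrite linearP.
have lr (k : nat) : linear (rsubmx : 'rV[R]_(n + k) -> 'rV_k).
  by move=> a x y; rewrite linearP.
rewrite /Omega fevalN; congr (- _).
(* The alternating sum is itself multilinear and alternating, so the comparison can be made on basis
   tuples. *)
rewrite -(feval_mkform (malt_extd (lr _) (ll _))) /dext /extd.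
congr (feval _ v); rewrite /mkform; apply/rowP => J; rewrite !mxE.
apply: eq_bigr => i _; congr (_ * _).
set b := basis_vec R _.
have -> : 'D_(b i) (localform (@Theta R n M m) (chart_at z)) (cmap (chart_at z) z) =
    fpull lsubmx (rsubmx (b i)).
  have lf : linear (fun y : 'rV[R]_(n + extdim n m) =>
      fpull (lsubmx : 'rV[R]_(n + extdim n m) -> 'rV_n) (rsubmx y)).
    by move=> a x y; rewrite lr fpull_linear.
  have [dd ed] := linear_diff (cmap (chart_at z) z) lf.
  rewrite -[RHS](congr1 (fun f => f (b i)) ed) -deriveE //.
  apply: near_eq_derive.
  have az := atlas_at hM z.1.
  apply: (near_open (open_over (N := extdim n m) (open_cimg hM az))).
    by rewrite /over /= row_mxKl; exists z.1 => //; exact: dom_at.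
  by move=> y py; exact: localform_Theta.
by rewrite feval_fpull.
Qed.
End FormBundle.

(** * Lagrangian subspaces that are images of sections *)

Section LinearLagrangian.
Variables (R : realType) (N m : nat) (eta : 'rV[R]_(extdim N m.+1)).
Implicit Types (v : 'rV[R]_N) (s : 'I_m -> 'rV[R]_N).

Lemma vcons0 v s : vcons v s ord0 = v.
Proof. by rewrite /vcons unlift_none. Qed.

Lemma vconsS v s i : vcons v s (lift ord0 i) = s i.
Proof. by rewrite /vcons liftK. Qed.

(** The [0] is a placeholder that [upd] overwrites; this form gives access to linearity in the first
    slot. *)
Lemma vcons_upd v s : vcons v s = upd (vcons 0 s) ord0 v.
Proof.
apply/funext => i; rewrite /upd; case: (unliftP ord0 i) => [j ->|->].
  by rewrite !vconsS.
by rewrite vcons0.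
Qed.

Lemma vcons_eta (a : 'I_m.+1 -> 'rV[R]_N) :
  vcons (a ord0) (a \o lift ord0) = a.
Proof.
by apply/funext => i; case: (unliftP ord0 i) => [j ->|->]; rewrite ?vconsS ?vcons0.
Qed.

Lemma feval_vconsD v v' s :
  feval eta (vcons (v + v') s) = feval eta (vcons v s) + feval eta (vcons v' s).
Proof.
rewrite (vcons_upd (v + v')) (vcons_upd v) (vcons_upd v').
exact/malt_updD/malt_feval.
Qed.

(** A full contraction has degree [m.+1 - m.+1]: its only argument is an empty tuple, and it carries
    a single scalar. *)
Lemma contract_full_eq0 v s :
  contract (wedge (vcons v s)) eta = 0 <-> feval eta (vcons v s) = 0.
Proof.
have e t : feval (contract (wedge (vcons v s)) eta) t = feval eta (vcons v s).
  rewrite feval_contract_wedge //; congr feval; apply/funext => i.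
  exact: vcatl.
split=> [h|h]; last by apply: feval_inj => t; rewrite e h feval0.
by rewrite -(e (fun=> 0)) h feval0.
Qed.

Lemma ker_flat1P v : ker_flat1 eta v <-> forall s, feval eta (vcons v s) = 0.
Proof.
(* The tail of [vcat] is indexed by ['I_(m.+1 - 1)] and that of [vcons] by ['I_m]; [em] mediates
   between them. *)
have em : m.+1.-1 = (m.+1 - 1)%N by rewrite subn1.
have e t : vcat (p := m.+1) (fun _ : 'I_1 => v) t =
    vcons v (t \o cast_ord em).
  apply/funext => i; case: (unliftP ord0 i) => [j ->|->].
    rewrite vconsS /=; apply: (vcatr (q := 1)); by rewrite /= /bump.
  by rewrite vcons0; apply: (vcatl (q := 1) _ _ (a := ord0)).
split=> h; last first.
  by apply: feval_inj => t; rewrite feval_contract_wedge // e h feval0.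
move=> s; have -> : s = (s \o cast_ord (esym em)) \o cast_ord em.
  by apply/funext => i /=; congr s; apply: val_inj.
rewrite -e -feval_contract_wedge //.
by rewrite (_ : contract _ _ = 0) ?feval0.
Qed.

(** The linear algebra of the theorem: [P] will be the projection to the base, [D] the differential
    of the section, and the last hypothesis the behaviour of [Omega_tilde] with a vertical first
    argument. *)
Lemma Lagrangian_section n (P : 'rV[R]_N -> 'rV[R]_n) (D : 'rV[R]_n -> 'rV[R]_N)
    (S : set 'rV[R]_N) :
  linear P -> (forall a, P (D a) = a) -> S = range D ->
  (forall v s s', P v = 0 -> P \o s = P \o s' ->
     feval eta (vcons v s) = feval eta (vcons v s')) ->
  Lagrangian eta m S <->
  forall a : 'I_m.+1 -> 'rV[R]_n, feval eta (D \o a) = 0.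
Proof.
move=> lP PD -> hv; split=> [lag a|h].
  have : orth eta m (range D) (D (a ord0)).
    (* An element of [S] lies in the sum with kernel part 0. *)
    rewrite lag; exists (D (a ord0)); first by exists (a ord0).
    exists 0; last by rewrite addr0.
    apply/ker_flat1P => s; apply: (malt_coord0 (i := ord0) (malt_feval eta)).
    exact: vcons0.
  move=> /(_ (D \o a \o lift ord0)) => o.
  rewrite -(vcons_eta (D \o a)); apply/contract_full_eq0/o => i.
  by exists (a (lift ord0 i)).
have hD a s : (forall i, range D (s i)) -> feval eta (vcons (D a) s) = 0.
  move=> Ds; have /choice[b hb] : forall i, exists b, D b = s i.
    by move=> i; have [b _ e] := Ds i; exists b.
  rewrite (_ : vcons (D a) s = D \o vcons a b) ?h //.
  apply/funext => i /=; rewrite /vcons; by case: unlift.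
apply/seteqP; split=> [v ov|_ [_ [a _ <-] [z kz <-]]]; last first.
  move=> s Ds; apply/contract_full_eq0.
  by rewrite feval_vconsD hD // add0r; exact: (ker_flat1P z).1.
exists (D (P v)); first by exists (P v).
exists (v - D (P v)); last by rewrite addrC subrK.
apply/ker_flat1P => s.
(* The vertical vector [v - D (P v)] cannot tell [s] from the tuple [D \o P \o s] of [S] with the
   same projections. *)
rewrite (hv _ s (D \o P \o s)); first last.
- by apply/funext => i /=; rewrite PD.
- have -> : v - D (P v) = -1 *: D (P v) + v by rewrite scaleN1r addrC.
  by rewrite lP PD scaleN1r addNr.
have Ds i : range D ((D \o P \o s) i) by exists (P (s i)).
(* On this tuple [D (P v)] contributes 0 because [eta] vanishes on [S], which leaves the value at
   [v], zero by orthogonality. *)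
have := feval_vconsD (v - D (P v)) (D (P v)) (D \o P \o s).
rewrite subrK (hD _ _ Ds) addr0 => <-.
exact: (contract_full_eq0 v (D \o P \o s)).1 (ov _ Ds).
Qed.
End LinearLagrangian.

(** * Local expressions of a multivector field and of the contraction map *)

Lemma lsubmx_linear (R : realType) n1 n2 :
  linear (lsubmx : 'rV[R]_(n1 + n2) -> 'rV_n1).
Proof. by move=> a x y; rewrite linearP. Qed.

Lemma diff_lsubmx_comp (R : realType) (V : normedModType R) n1 n2
    (f : V -> 'rV[R]_(n1 + n2)) x v : differentiable f x ->
  lsubmx ('d f x v) = 'd (lsubmx \o f) x v.
Proof.
move=> df; have [dl el] := linear_diff (f x) (@lsubmx_linear R n1 n2).
by rewrite (diff_comp df dl) /= el.
Qed.

Lemma diff_rsubmx_comp (R : realType) (V : normedModType R) n1 n2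
    (f : V -> 'rV[R]_(n1 + n2)) x v : differentiable f x ->
  rsubmx ('d f x v) = 'd (rsubmx \o f) x v.
Proof.
move=> df.
have lr : linear (rsubmx : 'rV[R]_(n1 + n2) -> 'rV_n2).
  by move=> a y z; rewrite linearP.
have [dl el] := linear_diff (f x) lr.
by rewrite (diff_comp df dl) /= el.
Qed.

Section MvBundle.
Variables (R : realType) (n q : nat) (M : charted R n) (hM : is_manifold M).
Implicit Types (c b d : chart R n M).

Definition mvchart c : chart R (n + extdim n q) (mvbundle M q) :=
  bundle_chart (fun A _ => @mvpush R n n q A) c.

(** As for forms, except that multivectors are covariant: the Jacobian goes from [c] to [b]. *)
Lemma mvchart_trans c b y : atlas M c -> atlas M b ->
  over (overlap c b) y ->
  (cmap (mvchart b) \o cinv (mvchart c)) y =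
  row_mx ((cmap b \o cinv c) (lsubmx y))
    (mvpush ('d (cmap b \o cinv c) (lsubmx y)) (rsubmx y)).
Proof.
move=> ac ab /(overlapP hM ac)[cx bx e] /=; set x := cinv c _ in cx bx e *.
apply: (congr1 (row_mx _)).
apply: (etrans (mvpush_comp _ _ (tcoord_linear b x))).
apply: (congr1 (fun A => mvpush A (rsubmx y))).
apply: (etrans (tjac_comp hM ac (atlas_at hM x) ab cx (dom_at hM x) bx)).
by rewrite /tjac e.
Qed.

Lemma smooth_mvchart_trans c b : atlas M c -> atlas M b ->
  smooth_on (over (N := extdim n q) (overlap c b))
    (cmap (mvchart b) \o cinv (mvchart c)).
Proof.
move=> ac ab k.
have oA := open_over (N := extdim n q) (open_overlap hM ac ab).
apply: (eq_Cn_on oA) => [z pz|]; first by apply/esym; exact: mvchart_trans.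
apply: Cn_on_row_mx => //.
  apply: (Cn_on_comp (B := overlap c b) (f := lsubmx) (g := cmap b \o cinv c)) => //.
    exact: Cn_on_linear.
  exact: smooth_trans.
apply: (Cn_on_mvpush (P := overlap c b)) => //.
- exact: smooth_trans.
- exact: Cn_on_linear.
- exact: Cn_on_linear.
Qed.

Lemma mvchart_cinvK c y : atlas M c -> over (cimg c) y ->
  cmap (mvchart c) (cinv (mvchart c) y) = y.
Proof.
move=> ac /(cinvK hM ac)[cx e]; rewrite -[RHS]hsubmxK /=; set x := cinv c _.
rewrite e; apply: (congr1 (row_mx _)).
apply: (etrans (mvpush_comp _ _ (tcoord_linear c x))).
apply: (etrans (congr1 (fun A => mvpush A (rsubmx y))
  (tjacK hM ac (atlas_at hM x) cx (dom_at hM x)))).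
exact: mvpush_id.
Qed.

Lemma mvchart_cmapK c (z : mvbundle M q) : atlas M c -> cdom c z.1 ->
  cinv (mvchart c) (cmap (mvchart c) z) = z.
Proof.
case: z => x u ac /= cx.
rewrite row_mxKl row_mxKr (cmapK hM) //; apply: (congr1 (pair x)).
apply: (etrans (mvpush_comp _ _ (tvec_linear c x))).
apply: (etrans (congr1 (fun A => mvpush A u)
  (tjacK hM (atlas_at hM x) ac (dom_at hM x) cx))).
exact: mvpush_id.
Qed.

End MvBundle.

Section Field.
Variables (R : realType) (n k q : nat) (M : charted R n).
Variables (w : dform M k.+1) (U : M -> mvbundle M q).
Hypotheses (hM : is_manifold M) (sw : smooth_form w) (qk : (q <= k.+1)%N).
Hypothesis hU : multivector_field U.
Implicit Types (c : chart R n M).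

Let N := extdim n q.
Let m := (k.+1 - q)%N.

Lemma field_proj x : (U x).1 = x. Proof. exact: hU.2. Qed.

(** The form sigma; [locally_hamiltonian w U] is its closedness by conversion. *)
Definition contract_field : dform M m :=
  fun x => contract ((U x).2 : 'rV_(extdim n q)) (w x).

Definition locsec c (y : 'rV[R]_n) : 'rV[R]_(n + N) :=
  cmap (mvchart q c) (U (cinv c y)).

(** Since [U x] lies over [x], all of [cimg c] is contained in the domain on which [smooth_map]
    gives smoothness. *)
Lemma smooth_locsec c : atlas M c -> smooth_on (cimg c) (locsec c).
Proof.
move=> ac j; have [_ /(_ j)] := hU.1 c (mvchart q c) ac (ex_intro2 _ _ c ac erefl).
apply: sub_Cn_on => _ [x cx <-]; exists x => //; split=> //=.
by rewrite field_proj.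
Qed.

Lemma lsub_locsec c y : atlas M c -> cimg c y -> lsubmx (locsec c y) = y.
Proof.
move=> ac /(cinvK hM ac)[_ e].
by rewrite /locsec /= row_mxKl field_proj.
Qed.

Lemma locsec_map c x : atlas M c -> cdom c x ->
  locsec c (cmap c x) = cmap (mvchart q c) (U x).
Proof. by move=> ac cx; rewrite /locsec (cmapK hM). Qed.

Definition locflat c : 'rV[R]_(n + N) -> 'rV[R]_(n + extdim n m) :=
  cmap (formchart m c) \o flat w \o cinv (mvchart q c).

(** [fpull_contract] along [tvec c x] absorbs the frame change of the multivector into the local
    expression of [w]. *)
Lemma locflatE c y : atlas M c -> over (cimg c) y ->
  locflat c y =
  row_mx (lsubmx y) (contract (rsubmx y) (localform w c (lsubmx y))).
Proof.
move=> ac /(cinvK hM ac)[cx e]; rewrite /locflat /localform /=.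
set x := cinv c _; rewrite e; apply: (congr1 (row_mx _)).
exact: (fpull_contract _ _ qk (tvec_linear c x)).
Qed.

Lemma diff_locflat c y : atlas M c -> over (cimg c) y ->
  differentiable (locflat c) y.
Proof.
move=> ac py.
have oA := open_over (N := N) (open_cimg hM ac).
suff H : Cn_on 1 (over (N := N) (cimg c)) (locflat c) by exact: (Cn_on_diff H py).
apply: (eq_Cn_on oA) => [z pz|]; first by apply/esym; exact: locflatE.
apply: Cn_on_row_mx => //; first exact: Cn_on_linear.
apply: Cn_on_contract => //; first exact: Cn_on_linear.
apply: (Cn_on_comp (B := cimg c) (f := lsubmx) (g := localform w c)) => //.
  exact: Cn_on_linear.
exact: sw.
Qed.

Lemma locflat_locsec c y : atlas M c -> cimg c y ->
  locflat c (locsec c y) = row_mx y (localform contract_field c y).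
Proof.
move=> ac /(cinvK hM ac)[cx e]; rewrite /locflat /locsec /localform.
set x := cinv c y in cx e *.
have -> : (cmap (formchart m c) \o flat w \o cinv (mvchart q c))
    (cmap (mvchart q c) (U x)) =
    cmap (formchart m c) (flat w (U x)).
  by rewrite /comp (mvchart_cmapK hM) // field_proj.
rewrite /= /flat /contract_field; move: (field_proj x); case: (U x) => p u /= ->.
by rewrite e.
Qed.

(** * Differentials at a point of the image, that is, where [U z.1 = z] *)

Section AtPoint.
Variables (z : mvbundle M q) (hz : U z.1 = z).
Variables (c : chart R n M) (ac : atlas M c) (cz : cdom c z.1).
Let y0 := cmap c z.1.
Let z0 := cmap (mvchart q c) z.

Let y0c : cimg c y0. Proof. by exists z.1. Qed.

Let z0c : over (cimg c) z0.
Proof. by rewrite /over /= row_mxKl. Qed.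

Let locsec0 : locsec c y0 = z0.
Proof. exact: (etrans (locsec_map ac cz) (congr1 (cmap (mvchart q c)) hz)). Qed.

Let dG : differentiable (locsec c) y0.
Proof. exact: (smooth_on_diff (smooth_locsec ac) y0c). Qed.

Let dF : differentiable (locflat c) (locsec c y0).
Proof.
exact: (eq_ind_r (fun y => differentiable (locflat c) y)
  (diff_locflat ac z0c) locsec0).
Qed.

(** Differentiates [lsub_locsec]; this will be the hypothesis [P (D a) = a] of
    [Lagrangian_section]. *)
Lemma lsub_dlocsec a : lsubmx ('d (locsec c) y0 a) = a.
Proof.
rewrite (diff_lsubmx_comp a dG).
have [di ei] := @linear_diff R n _ idfun y0 (fun _ _ _ => erefl).
suff h : 'd (lsubmx \o locsec c) y0 = 'd idfun y0 :> (_ -> _).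
  exact: (congr1 (fun f => f a) (etrans h ei)).
apply: (near_eq_diff _ di).2.
apply: (near_open (open_cimg hM ac) y0c) => y cy.
exact/esym/lsub_locsec.
Qed.

(** The contraction map covers the identity of [M], so its differential preserves horizontal
    parts. *)
Lemma lsub_dlocflat v : lsubmx ('d (locflat c) z0 v) = lsubmx v.
Proof.
rewrite (diff_lsubmx_comp v (diff_locflat ac z0c)).
have [dl el] := linear_diff z0 (@lsubmx_linear R n N).
suff h : 'd (lsubmx \o locflat c) z0 = 'd (lsubmx : 'rV_(n + N) -> 'rV_n) z0 :> (_ -> _).
  exact: (congr1 (fun f => f v) (etrans h el)).
apply: (near_eq_diff _ dl).2.
apply: (near_open (open_over (N := N) (open_cimg hM ac)) z0c) => y py.
by rewrite /comp (locflatE ac py) row_mxKl.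
Qed.

(** By [locflat_locsec], sigma is locally the fibre part of a composite of differentiable maps. *)
Lemma diff_localform_contract_field : differentiable (localform contract_field c) y0.
Proof.
have dR : differentiable (rsubmx \o (locflat c \o locsec c)) y0.
  apply: (differentiable_comp (differentiable_comp dG dF)).
  exact: differentiable_rsubmx.
apply: (near_eq_diff _ dR).1.
apply: (near_open (open_cimg hM ac) y0c) => y cy.
by rewrite /comp (locflat_locsec ac cy) row_mxKr.
Qed.

(** The chain rule applied to [locflat_locsec]: on vectors tangent to the image, the vertical part
    of the differential of [flat] is a derivative of sigma. *)
Lemma rsub_dlocflat_dlocsec a :
  rsubmx ('d (locflat c) z0 ('d (locsec c) y0 a)) = 'D_a (localform contract_field c) y0.
Proof.
have e : 'd (locflat c) z0 ('d (locsec c) y0 a) =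
    'd (locflat c \o locsec c) y0 a.
  apply: (etrans _ (esym (congr1 (fun f => f a) (diff_comp dG dF)))).
  exact: (congr1 (fun y => 'd (locflat c) y ('d (locsec c) y0 a)) (esym locsec0)).
apply: (etrans (congr1 rsubmx e)).
apply: (etrans (diff_rsubmx_comp a (differentiable_comp dG dF))).
apply: (etrans _ (esym (deriveE a diff_localform_contract_field))).
suff h : 'd (rsubmx \o (locflat c \o locsec c)) y0 =
    'd (localform contract_field c) y0 :> (_ -> _) by exact: (congr1 (fun f => f a) h).
apply: (near_eq_diff _ diff_localform_contract_field).2.
apply: (near_open (open_cimg hM ac) y0c) => y cy.
by rewrite /comp (locflat_locsec ac cy) row_mxKr.
Qed.

End AtPoint.

Section Eval.
Variables (z : mvbundle M q) (hz : U z.1 = z).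
Let c := chart_at z.1.
Let y0 := cmap c z.1.
Let z0 := cmap (mvchart q c) z.

(** The distinguished charts at [z] and at [flat w z] both come from [chart_at z.1], so the tangent
    map of [flat] is the differential of [locflat] by conversion. *)
Lemma Omega_tilde_eval (v : 'I_m.+1 -> 'rV[R]_(n + N)) :
  feval (Omega_tilde (q := q) w z) v = - \sum_(i < m.+1) (-1) ^+ i *
    feval (rsubmx ('d (locflat c) z0 (v i))) (fun j => lsubmx (v (lift i j))).
Proof.
rewrite /Omega_tilde /pullback feval_fpull; last exact: diff_linear.
rewrite (Omega_eval hM); congr (- _); apply: eq_bigr => i _; congr (_ * feval _ _).
apply/funext => j.
exact: (lsub_dlocflat (atlas_at hM z.1) (dom_at hM z.1) (v (lift i j))).
Qed.

(** On vectors of the form ['d (locsec c) y0 (a i)] the vertical parts in [Omega_tilde_eval] are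
    derivatives of sigma and the horizontal parts are the [a i]: the sum becomes that of the
    exterior derivative. *)
Lemma dext_contract_field_eval (a : 'I_m.+1 -> 'rV[R]_n) :
  feval (dext contract_field z.1) a =
  - feval (Omega_tilde (q := q) w z) ('d (locsec c) y0 \o a).
Proof.
rewrite Omega_tilde_eval opprK /dext /extd.
rewrite feval_mkform; last first.
  apply: (malt_extd (L := fun v => 'D_v (localform contract_field c) y0)
    (B := idfun)) => //.
  move=> b u v; rewrite !deriveE ?linearP //;
  exact: (diff_localform_contract_field hz (atlas_at hM z.1) (dom_at hM z.1)).
apply: eq_bigr => i _; congr (_ * _).
rewrite (rsub_dlocflat_dlocsec hz (atlas_at hM z.1) (dom_at hM z.1)).
congr (feval _ _); apply/funext => j.
exact: (esym (lsub_dlocsec (atlas_at hM z.1) (dom_at hM z.1) (a (lift i j)))).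
Qed.
End Eval.
End Field.

(** * Tangent spaces of the image *)

Lemma open_norm_lt (R : realType) (e : R) : 0 < e ->
  open [set t : R^o | `|t| < e].
Proof.
move=> e0; have -> : [set t : R^o | `|t| < e] = ball (0 : R^o) e.
  by apply/seteqP; split=> t; rewrite -ball_normE /ball_ /= sub0r normrN.
exact: ball_open.
Qed.

Section Affine.
Variables (R : realType) (n : nat) (y a : 'rV[R]_n).

Lemma is_diff_affine (t : R^o) :
  is_diff t (fun s : R^o => y + s *: a) (fun s : R^o => s *: a).
Proof.
have h : is_diff t (cst y + (fun s : R^o => s *: a)) (0 + (fun s : R^o => s *: a)).
  exact: is_diffD.
by apply: (is_diff_eq h); rewrite add0r.
Qed.

Lemma Cn_on_affine k (A : set R^o) : Cn_on k A (fun s : R^o => y + s *: a).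
Proof.
case: k => [|k] /=.
  by move=> t _; apply: differentiable_continuous; have [] := is_diff_affine t.
split=> [t _|v]; first by have [] := is_diff_affine t.
have -> : 'D_v (fun s : R^o => y + s *: a) = cst (v *: a) :> (R^o -> _).
  by apply/funext => t; have [d e] := is_diff_affine t; rewrite deriveE // e.
exact: Cn_on_cst.
Qed.
End Affine.

Lemma derive1_line (R : realType) n N (G : 'rV[R]_n -> 'rV[R]_N) y a :
  differentiable G y -> derive1 (fun t : R => G (y + t *: a)) 0 = 'd G y a.
Proof.
move=> dG; have [da ea] := is_diff_affine y a 0.
have dG' : differentiable G ((fun s : R^o => y + s *: a) 0).
  by rewrite scale0r addr0.
have dc := differentiable_comp da dG'.
rewrite derive1E (@deriveE _ R^o _ _ _ _ dc).
have := congr1 (fun f => f 1) (diff_comp da dG').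
by rewrite /= ea scale1r scale0r addr0.
Qed.

(** A curve in a graph equals [G] composed with its own projection; the chain rule at 0 gives the
    velocity. *)
Lemma derive1_graph (R : realType) n N (G : 'rV[R]_n -> 'rV[R]_(n + N))
    (f : R^o -> 'rV[R]_(n + N)) (A : set R^o) : open A -> A 0 ->
  differentiable f 0 -> differentiable G (lsubmx (f 0)) ->
  (forall t, A t -> f t = G (lsubmx (f t))) ->
  derive1 f 0 = 'd G (lsubmx (f 0)) (lsubmx (derive1 f 0)).
Proof.
move=> oA A0 df dG fG.
have [dl el] := linear_diff (f 0) (@lsubmx_linear R n N).
have dlf := differentiable_comp df dl.
have dc := differentiable_comp dlf (dG : differentiable G ((lsubmx \o f) 0)).
have [_ h] := near_eq_diff (f := f) (g := G \o (lsubmx \o f))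
  (near_open oA A0 fG) df.
have e1 : derive1 f 0 = 'd f 0 1.
  by rewrite derive1E (@deriveE _ R^o _ _ _ _ df).
have e2 : 'd f 0 1 = 'd G (lsubmx (f 0)) ('d (lsubmx \o f) 0 1).
  exact: (etrans (congr1 (fun F => F 1) (esym h))
    (congr1 (fun F => F 1) (diff_comp dlf dG))).
have e3 : 'd (lsubmx \o f) 0 1 = lsubmx ('d f 0 1).
  exact: (etrans (congr1 (fun F => F 1) (diff_comp df dl))
    (congr1 (fun F => F ('d f 0 1)) el)).
exact: (etrans e1 (etrans e2 (congr1 ('d G (lsubmx (f 0)))
  (etrans e3 (congr1 lsubmx (esym e1)))))).
Qed.

Section Tangent.
Variables (R : realType) (n q : nat) (M : charted R n).
Variables (U : M -> mvbundle M q).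
Hypotheses (hM : is_manifold M) (hU : multivector_field U).

(** Curves in the image stay on the graph of the local section, so [derive1_graph] applies to them.
    Conversely, [a] is realised by lifting the straight line [y0 + t *: a]. *)
Lemma tangent_space_section (z : mvbundle M q) : U z.1 = z ->
  tangent_space (range U) z =
  range ('d (locsec U (chart_at z.1)) (cmap (chart_at z.1) z.1)).
Proof.
move=> hz; set c := chart_at z.1; set y0 := cmap c z.1.
have ac : atlas M c by exact: atlas_at.
have cz : cdom c z.1 by exact: dom_at.
have y0c : cimg c y0 by exists z.1.
have dG : differentiable (locsec U c) y0.
  exact: (smooth_on_diff (smooth_locsec hU ac) y0c).
apply/seteqP; split=> [v [e [g [e0 hg g0 sg ->]]]|_ [a _ <-]].
- have Gg t : `|t| < e -> cmap (mvchart q c) (g t) =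
      locsec U c (lsubmx (cmap (mvchart q c) (g t))).
    move=> te; have [[x _ Ux] ct] := hg t te.
    have ct' : cdom c x by move: ct; rewrite -Ux /= (field_proj hU).
    by rewrite -Ux [in RHS]/= row_mxKl (field_proj hU) locsec_map.
  have g0l : lsubmx (cmap (mvchart q c) (g 0)) = y0 by rewrite g0 row_mxKl.
  exists (lsubmx (derive1 (cmap (mvchart q c) \o g) 0)) => //.
  rewrite -[in LHS]g0l.
  apply/esym/(derive1_graph (A := [set t : R^o | `|t| < e])) => //=.
  + exact: open_norm_lt.
  + by rewrite normr0.
  + by apply: (smooth_on_diff sg) => /=; rewrite normr0.
  + by rewrite g0l.
- have oc := open_cimg hM ac.
  (* The line stays in the open chart image for a short time only, which fixes [e]. *)
  have [e e0 he] : exists2 e, 0 < e & forall t : R, `|t| < e -> cimg c (y0 + t *: a).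
    have [dd _] := is_diff_affine y0 a 0.
    have : \forall t \near (0 : R^o), cimg c (y0 + t *: a).
      apply: (differentiable_continuous dd).
      by rewrite scale0r addr0; exact: open_nbhs_nbhs.
    move=> /nbhs_ballP[e e0 he]; exists e => // t te; apply: he.
    by rewrite -ball_normE /ball_ /= sub0r normrN.
  exists e, (fun t => U (cinv c (y0 + t *: a))); split => //.
  + move=> t /he/(cinvK hM ac)[ct _]; split; first by exists (cinv c (y0 + t *: a)).
    by rewrite /= (field_proj hU).
  + by rewrite scale0r addr0 (cmapK hM).
  + move=> k.
    apply: (Cn_on_comp (B := cimg c) (f := fun t : R^o => y0 + t *: a)
      (g := locsec U c)) => //.
    * exact: open_norm_lt.
    * exact: Cn_on_affine.
    * exact: smooth_locsec.
  + exact/esym/derive1_line.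
Qed.
End Tangent.

(** * The Lagrangian condition at a point of the image *)

Section Main.
Variables (R : realType) (n k q : nat) (M : charted R n).
Variables (w : dform M k.+1) (U : M -> mvbundle M q).
Hypotheses (hM : is_manifold M) (sw : smooth_form w) (qk : (q <= k.+1)%N).
Hypothesis hU : multivector_field U.

Lemma Lagrangian_tangent (z : mvbundle M q) : U z.1 = z ->
  Lagrangian (Omega_tilde (q := q) w z) (k.+1 - q) (tangent_space (range U) z) <->
  dext (contract_field w U) z.1 = 0.
Proof.
move=> hz; set c := chart_at z.1; set y0 := cmap c z.1.
have ac : atlas M c by exact: atlas_at.
have cz : cdom c z.1 by exact: dom_at.
have ll := @lsubmx_linear R n (extdim n q).
have lH := lsub_dlocflat hM sw qk ac cz.
apply: (iff_trans (Lagrangian_section ll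
  (lsub_dlocsec hM hU ac cz) (tangent_space_section hM hU hz) _)).
  move=> v s s' v0 ss'; rewrite !(Omega_tilde_eval hM sw qk); congr (- _).
  (* The term of index 0 sees only the horizontal parts of [s]; each of the others has the
     horizontal part of [v], which is zero, in its first slot. *)
  rewrite !big_ord_recl /=; congr (_ + _).
    rewrite !vcons0; congr (_ * feval _ _); apply/funext => j.
    rewrite !vconsS; exact: (congr1 (fun f => f j) ss').
  have z0 (t : 'I_(k.+1 - q) -> 'rV[R]_(n + extdim n q)) a (i : 'I_(k.+1 - q)) :
      feval a (fun j => lsubmx (vcons v t (lift (lift ord0 i) j))) = 0.
    (* The existence of [i] shows that the degree is positive, so a slot 0 exists. *)
    have j0 : (0 < k.+1 - q)%N by exact: leq_ltn_trans (ltn_ord i).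
    apply: (malt_coord0 (i := Ordinal j0) (malt_feval a)).
    rewrite (_ : lift _ _ = ord0) ?vcons0 //; exact: val_inj.
  by apply: eq_bigr => i _; rewrite !z0.
split=> [h|h a].
  apply: feval_inj => a; rewrite (dext_contract_field_eval hM sw qk hU hz) feval0.
  by apply/eqP; rewrite oppr_eq0; apply/eqP/h.
apply/eqP; rewrite -oppr_eq0 -(dext_contract_field_eval hM sw qk hU hz) h.
by rewrite feval0.
Qed.
End Main.

(** * Slice charts *)

Section Slice.
Variables (R : realType) (n q : nat) (M : charted R n).
Variables (U : M -> mvbundle M q).
Hypotheses (hM : is_manifold M) (hU : multivector_field U).
Let N := extdim n q.
Variables (c : chart R n M) (ac : atlas M c).

(** With [a = -1] it moves the image of [U] to the zero section, and [a = 1] is the inverse; the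
    parameter lets both share one smoothness proof. *)
Definition shear (a : R) (y : 'rV[R]_(n + N)) : 'rV[R]_(n + N) :=
  row_mx (lsubmx y) (rsubmx y + a *: rsubmx (locsec U c (lsubmx y))).

Lemma lsub_shear a y : lsubmx (shear a y) = lsubmx y.
Proof. exact: row_mxKl. Qed.

Lemma shearK a y : shear (- a) (shear a y) = y.
Proof.
rewrite {1}/shear lsub_shear /shear row_mxKr -addrA -scalerDl subrr scale0r addr0.
exact: hsubmxK.
Qed.

Lemma shearNK y : shear 1 (shear (-1) y) = y.
Proof. by have := shearK (-1) y; rewrite opprK. Qed.

Lemma Cn_on_shear k a : Cn_on k (over (N := N) (cimg c)) (shear a).
Proof.
have oA := open_over (N := N) (open_cimg hM ac).
have Cl : Cn_on k (over (N := N) (cimg c)) lsubmx by exact: Cn_on_linear.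
apply: Cn_on_row_mx => //; apply: Cn_onD => //; first exact: Cn_on_linear.
pose L : 'rV[R]_(n + N) -> 'rV_N := fun y => a *: rsubmx y.
have lL : linear L by move=> b u v; rewrite /L linearP scalerDr !scalerA mulrC.
apply: (Cn_on_comp (B := setT) (f := locsec U c \o lsubmx) (g := L)) => //.
  apply: (Cn_on_comp (B := cimg c) (f := lsubmx) (g := locsec U c)) => //.
  exact: smooth_locsec.
pose LM := GRing.isLinear.Build R _ _ _ L lL.
pose LL : {linear 'rV[R]_(n + N) -> 'rV_N} := HB.pack L LM.
exact: (Cn_on_linear k setT LL).
Qed.

Definition slice : chart R (n + N) (mvbundle M q) :=
  Chart (cdom (mvchart q c)) (shear (-1) \o cmap (mvchart q c))
    (cinv (mvchart q c) \o shear 1).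

Lemma cmap_slice z : cmap slice z = shear (-1) (cmap (mvchart q c) z).
Proof. by []. Qed.

Lemma cinv_slice y : cinv slice y = cinv (mvchart q c) (shear 1 y).
Proof. by []. Qed.

Lemma lsub_slice z : lsubmx (cmap slice z) = cmap c z.1.
Proof. exact: (etrans (lsub_shear _ _) (row_mxKl _ _)). Qed.

Lemma slice_cinvK y : over (cimg c) y -> cmap slice (cinv slice y) = y.
Proof.
move=> py; rewrite cmap_slice cinv_slice.
have p1 : over (cimg c) (shear 1 y) by rewrite /over /= lsub_shear.
by rewrite (mvchart_cinvK hM ac p1) shearK.
Qed.

Lemma slice_cmapK z : cdom c z.1 -> cinv slice (cmap slice z) = z.
Proof.
by move=> cz; rewrite cmap_slice cinv_slice shearNK; exact: mvchart_cmapK.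
Qed.

Lemma cimg_slice : cimg slice = over (cimg c).
Proof.
apply/seteqP; split=> [_ [z cz <-]|y py].
  by rewrite overE lsub_slice; exists z.1.
exists (cinv slice y); last exact: slice_cinvK.
by rewrite /slice /= lsub_shear; have [] := cinvK hM ac py.
Qed.

Lemma chart_wf_slice : chart_wf slice.
Proof.
split=> [|z]; last exact: slice_cmapK.
by rewrite cimg_slice; exact: open_over (open_cimg hM ac).
Qed.

Section Compat.
Variables (b : chart R n M) (ab : atlas M b).

(** The transition is a shear, which preserves base coordinates, followed by a transition of bundle
    charts; the opposite transition composes in the other order. *)
Lemma slice_to_bundle : smooth_transition slice (mvchart q b).
Proof.
have E : cmap slice @` (cdom slice `&` cdom (mvchart q b)) = over (overlap c b).
  apply/seteqP; split=> [_ [z [cz bz] <-]|y py].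
    by rewrite overE lsub_slice; exact: overlap_map.
  have [cx bx e] := overlapP hM ac py.
  exists (cinv slice y); first by split; rewrite /= lsub_shear.
  by apply: slice_cinvK; case: py => x [? _] ?; exists x.
have oA := open_over (N := N) (open_overlap hM ac ab).
rewrite /smooth_transition E; split=> // k.
apply: (Cn_on_comp (B := over (overlap c b)) (f := shear 1)
  (g := cmap (mvchart q b) \o cinv (mvchart q c))) => //.
- by move=> y py; rewrite overE lsub_shear.
- apply: sub_Cn_on (Cn_on_shear k 1) => y [x [cx _] e]; by exists x.
- exact: smooth_mvchart_trans.
Qed.

Lemma bundle_to_slice : smooth_transition (mvchart q b) slice.
Proof.
have E : cmap (mvchart q b) @` (cdom (mvchart q b) `&` cdom slice) = over (overlap b c).
  apply/seteqP; split=> [_ [z [bz cz] <-]|y py].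
    by rewrite /over /= row_mxKl; exact: overlap_map.
  have [bx cx e] := overlapP hM ab py.
  exists (cinv (mvchart q b) y); first by split.
  by apply: mvchart_cinvK => //; case: py => x [? _] ?; exists x.
have oA := open_over (N := N) (open_overlap hM ab ac).
rewrite /smooth_transition E; split=> // k.
apply: (Cn_on_comp (B := over (cimg c))
  (f := cmap (mvchart q c) \o cinv (mvchart q b))
  (g := shear (-1))) => //.
- move=> y /(overlapP hM ab)[bx cx e].
  by rewrite /over /= row_mxKl; exists (cinv b (lsubmx y)).
- exact: smooth_mvchart_trans.
- exact: Cn_on_shear.
Qed.
End Compat.

(** The coordinates of index at least [n] are those of the fibre, and the shear subtracts from the
    fibre part of [U x] that part itself. *)
Lemma slice_range :
  cmap slice @` (range U `&` cdom slice) =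
  cimg slice `&` [set y | forall i : 'I_(n + N), (n <= i)%N -> y 0 i = 0].
Proof.
have sU x : cdom c x -> cmap slice (U x) = row_mx (cmap c x) 0.
  move=> cx; rewrite -[LHS]hsubmxK lsub_slice (field_proj hU).
  apply: (congr1 (row_mx _)).
  apply: (etrans (row_mxKr _ _)).
  have l : lsubmx (cmap (mvchart q c) (U x)) = cmap c x.
    by rewrite /= row_mxKl (field_proj hU).
  by rewrite l (locsec_map U hM ac cx) scaleN1r subrr.
rewrite cimg_slice; apply/seteqP; split=> [_ [_ [[x _ <-] cx] <-]|y [py y0]].
  have {}cx : cdom c x by move: cx; rewrite /= (field_proj hU).
  rewrite sU //; split; first by rewrite /over /= row_mxKl; exists x.
  move=> i; rewrite -(fintype.splitK i); case: (fintype.split i) => j /=.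
    by rewrite leqNgt ltn_ord.
  by rewrite row_mxEr mxE.
have [cx e] := cinvK hM ac py.
exists (U (cinv c (lsubmx y))).
  by split; [exists (cinv c (lsubmx y))|rewrite /= (field_proj hU)].
rewrite sU // e -[RHS]hsubmxK; apply: (congr1 (row_mx _)).
by apply/rowP => j; rewrite !mxE y0 //= leq_addr.
Qed.
End Slice.

Lemma submanifold_section (R : realType) (n q : nat) (M : charted R n)
    (U : M -> mvbundle M q) : is_manifold M -> multivector_field U ->
  submanifold n (range U).
Proof.
move=> hM hU; split; first exact: leq_addr.
move=> _ [x _ <-]; have ac := atlas_at hM x.
exists (slice U (chart_at x)); split.
- split; first exact: chart_wf_slice.
  move=> _ [b ab <-]; split; first exact: slice_to_bundle.
  exact: bundle_to_slice.
- by rewrite /= (field_proj hU); exact: dom_at.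
- exact: slice_range.
Qed.

Theorem theorem3p2p1 (R : realType) (n k q : nat) (M : charted R n)
  (w : dform M k.+1) (hM : is_manifold M) (hw : multisymplectic w)
  (hq : (1 <= q <= k)%N) (U : M -> mvbundle M q) (hU : multivector_field U) :
  locally_hamiltonian w U <->
  Lagrangian_submanifold (Omega_tilde (q := q) w) (k.+1 - q) (range U).
Proof.
have [sw _] := hw.
have qk : (q <= k.+1)%N by case/andP: hq => _ /leqW.
(* Points of the image have the form [U x], and [field_proj] gives the condition [U z.1 = z]
   there. *)
have lag (x : M) := Lagrangian_tangent hM sw qk hU (congr1 U (field_proj hU x)).
split=> [lh|[_ L] x].
  split; first by exists n; exact: submanifold_section.
  move=> _ [x _ <-]; apply/lag; exact: lh.
have := (lag x).1 (L (U x) (imageT U x)).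
by rewrite field_proj.
Qed.
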